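(* Let $p$ be a prime, and let $H \leq \mathbb{F}_p^*$ be a proper multiplicative subgroup (i.e. $H\neq\mathbb{F}_p^*$). Suppose that $H=A+B$ for some $A,B\subseteq\mathbb{F}_p$. Then one of the following holds: (1) $|A|=1$ or $|B|=1$; (2) $|A|=|B|=2$, $|H|=4$ and $p\equiv 1\pmod 4$. In particular, no proper multiplicative subgroup $H$ of $\mathbb{F}_p^*$ can be written as $H=A+B$ with $|A|,|B|>2$.
   Context: $\mathbb{F}_p$ is the field with $p$ elements and $\mathbb{F}_p^*$ its multiplicative group. For $A,B\subseteq\mathbb{F}_p$, the sumset is $A+B=\{a+b: a\in A, b\in B\}$. *)

(* Defs.v *)
From mathcomp Require Import all_boot all_order all_algebra all_fingroup.

Set Implicit Arguments.
Unset Strict Implicit.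
Unset Printing Implicit Defensive.

Import GRing.Theory.
Local Open Scope ring_scope.

Definition sumset (V : finZmodType) (A B : {set V}) : {set V} :=
  [set a + b | a in A, b in B].

(* {unit R} is a separate type from R, so a set of units must be mapped into R
   before it can be compared with a sumset; FinRing.uval is the injection. *)
Definition units_in (R : finUnitRingType) (H : {set {unit R}}) : {set R} :=
  [set FinRing.uval u | u in H].

(* Main.v *)
Require Import Defs.
From mathcomp Require Import all_boot all_order all_algebra all_fingroup.
From mathcomp Require Import all_solvable all_field.
From mathcomp Require Import ring zify.

Set Implicit Arguments.
Unset Strict Implicit.
Unset Printing Implicit Defensive.
Import GRing.Theory.

(** Put n = #|A|, m = #|B|, d = #|H|, S = -A and T = B, so that every difference
    t - s with t in T and s in S is a d-th root of unity, and let g and f be the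
    monic polynomials with root sets S and T.

    Stepanov's method, in the form of Hanson and Petridis, considers the
    divided difference over s in S of (x - s)^(d + n - 1).  It has degree d, and
    because (t - s)^d = 1 it differs by a constant from a polynomial P vanishing
    to order n at each t in T.  Hence m n <= d ([stepanov_bound]).
    Since A + B has at most m n elements, A + B = H forces d = m n: all the sums
    are distinct and P = C f^n ([stepanov_extremal]).

    This last identity is very rigid.  Expanded at t in T it says that
    the first d coefficients of (f(t + y) / y)^n are those of 1 / g(t + y) times
    explicit constants ([local_relations]).  At first order,
    the polynomial n(n+1) f''g - 2(d-1) f'g' + m(m+1) g''f vanishes on T, and on
    S because S and T play symmetric roles; having degree less than m + n, it
    is zero ([ode_eq0]).

    Combining this differential equation with the vanishing of the power sums
    of the elements of H gives n = m ([extremal_card_eq]): both are linear in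
    the power sums of S and T (about the mean of T) of the first degree in which
    these do not all vanish.

    Let n = m, so d = n^2.  The second order local relation gives a second
    identity, which is skew in f and g ([skew_form_eq0]).  At third order there
    are then three linear relations for two unknowns, and their compatibility
    reads (n-2)(3n^2+4n-1)(3n^4+5n^3-2n^2-5n+2) = 0 modulo p
    ([square_obstruction]).

    Finally p = q n^2 + 1 with q >= 2, as H is a proper subgroup.  Reducing with
    q n^2 = -1 turns the congruence into one between integers of size comparable
    with p, and for n > 2 only n = 3, p = 19 is left.  This case needs an
    enumeration ([no_decomposition19]): if C is a coset of the cube roots of
    unity made of nonsquares modulo 19, then S = -C and T = C satisfy all the
    identities above between f and g, and only the coincidences a + b = b + a
    keep C + C from being the whole group of squares. *)

Local Open Scope ring_scope.

(** * Root polynomials and Lagrange interpolation *)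

Section RootPoly.
Variable F : finFieldType.
Implicit Types (S T : {set F}) (s t x : F) (q : {poly F}).

Definition rootpoly S : {poly F} := \prod_(s in S) ('X - s%:P).

Lemma rootpolyD1 S s :
  s \in S -> rootpoly S = ('X - s%:P) * rootpoly (S :\ s).
Proof. by move=> sS; rewrite /rootpoly (big_setD1 s). Qed.

Lemma monic_rootpoly S : rootpoly S \is monic.
Proof. by apply: monic_prod => s _; apply: monicXsubC. Qed.

Lemma rootpoly_neq0 S : rootpoly S != 0.
Proof. exact: monic_neq0 (monic_rootpoly S). Qed.

Lemma size_rootpoly S : size (rootpoly S) = #|S|.+1.
Proof. by rewrite /rootpoly -big_enum /= size_prod_XsubC cardE. Qed.

Lemma rootpoly_root S x : root (rootpoly S) x = (x \in S).
Proof. by rewrite /rootpoly -big_enum /= root_prod_XsubC mem_enum. Qed.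

Lemma deriv_rootpoly S s :
  s \in S -> (rootpoly S)^`().[s] = (rootpoly (S :\ s)).[s].
Proof.
move=> sS; rewrite (rootpolyD1 sS) derivM derivXsubC mul1r hornerD hornerM.
by rewrite hornerXsubC subrr mul0r addr0.
Qed.

Lemma deriv_rootpoly_neq0 S s : s \in S -> (rootpoly S)^`().[s] != 0.
Proof.
move=> sS; rewrite deriv_rootpoly // -[_ == 0]/(root _ _) rootpoly_root.
by rewrite !inE eqxx.
Qed.

Lemma poly_eq0_on S q :
  (size q <= #|S|)%N -> {in S, forall s, q.[s] = 0} -> q = 0.
Proof.
move=> szq q0; apply/eqP/contraT => nzq.
have rootq : all (root q) (enum S).
  by apply/allP => s; rewrite mem_enum => /q0/eqP.
by have := max_poly_roots nzq rootq (enum_uniq _); rewrite -cardE ltnNge szq.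
Qed.

Lemma lagrange_interpolation S q : (size q <= #|S|)%N ->
  \sum_(s in S) (q.[s] / (rootpoly S)^`().[s]) *: rootpoly (S :\ s) = q.
Proof.
move=> szq; apply/eqP; rewrite -subr_eq0; apply/eqP.
apply: (@poly_eq0_on S) => [|s sS].
  rewrite (leq_trans (size_polyD _ _)) // geq_max size_polyN szq andbT.
  apply: (leq_trans (size_sum _ _ _)); apply/bigmax_leqP => s sS.
  apply: (leq_trans (size_scale_leq _ _)).
  by rewrite size_rootpoly [#|S|](cardsD1 s) sS.
rewrite hornerD hornerN horner_sum (bigD1 s) //= big1 ?addr0 => [|x].
  by rewrite hornerZ -deriv_rootpoly // mulfVK ?subrr // deriv_rootpoly_neq0.
case/andP=> xS xs; rewrite hornerZ; apply/eqP; rewrite mulf_eq0; apply/orP.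
by right; rewrite -[_ == 0]/(root _ _) rootpoly_root !inE eq_sym xs.
Qed.

Definition divided_difference S (h : F -> F) : F :=
  \sum_(s in S) h s / (rootpoly S)^`().[s].

Lemma divided_difference_poly S q : (size q <= #|S|)%N ->
  divided_difference S (horner q) = q`_#|S|.-1.
Proof.
move=> szq; rewrite -{2}(lagrange_interpolation szq) coef_sum.
apply: eq_bigr => s sS; rewrite coefZ.
have -> : #|S|.-1 = (size (rootpoly (S :\ s))).-1.
  by rewrite size_rootpoly [#|S|](cardsD1 s) sS.
by rewrite -/(lead_coef _) (monicP (monic_rootpoly _)) mulr1.
Qed.

End RootPoly.

(** * Stepanov's polynomial *)

Section Stepanov.
Variable F : finFieldType.
Variables (S T : {set F}) (d : nat) (eps : F).
Hypothesis S_gt0 : (0 < #|S|)%N.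
Hypothesis diffE : {in T & S, forall t s, (t - s) ^+ d = eps}.
Local Notation n := #|S|.
Local Notation N := (d + n.-1)%N.

Lemma coef_XaddC_exp (c : F) k i : (('X + c%:P) ^+ k)`_i = c ^+ (k - i) *+ 'C(k, i).
Proof.
rewrite addrC exprDn coef_sum.
case: (leqP i k) => [ik|ki].
  rewrite (bigD1 (Ordinal (ik : (i < k.+1)%N))) //= big1 => [|j /negPf ji].
    by rewrite addr0 coefMn -rmorphXn /= coefCM coefXn eqxx mulr1.
  rewrite coefMn -rmorphXn /= coefCM coefXn eq_sym.
  by rewrite -[i]/(val (Ordinal (ik : (i < k.+1)%N))) val_eqE ji mulr0 mul0rn.
rewrite bin_small // mulr0n big1 // => j _.
rewrite coefMn -rmorphXn /= coefCM coefXn.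
by rewrite gtn_eqF ?mulr0 ?mul0rn // (leq_ltn_trans _ ki) // -ltnS.
Qed.

(** The constant is the value taken at every t in T by the divided difference: there
    (t - s)^(d + n - 1) = eps (t - s)^(n - 1), whose divided difference in s is
    (-1)^(n - 1) eps. *)
Definition stepanov : {poly F} :=
  \sum_(s in S) (rootpoly S)^`().[s]^-1 *: ('X - s%:P) ^+ N - ((-1) ^+ n.-1 * eps)%:P.

Lemma coef_stepanov_shift t i :
  (stepanov \Po ('X + t%:P))`_i =
  divided_difference S (fun s => (t - s) ^+ (N - i)) *+ 'C(N, i)
  - (if i == 0%N then (-1) ^+ n.-1 * eps else 0).
Proof.
rewrite /stepanov rmorphB /= comp_polyC coefB coefC; congr (_ - _).
rewrite rmorph_sum coef_sum /divided_difference -sumrMnl; apply: eq_bigr => s _ /=.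
rewrite linearZ /= rmorphXn /= rmorphB /= comp_polyX comp_polyC coefZ.
by rewrite -addrA -polyCB coef_XaddC_exp mulrC mulrnAl.
Qed.

(** A divided difference over n points kills degrees below n - 1 and returns the
    leading coefficient in degree n - 1; in s, that of (t - s)^k is (-1)^k. *)
Lemma divided_difference_low t k : (k <= n.-1)%N ->
  divided_difference S (fun s => (t - s) ^+ k) = ((-1) ^+ k *+ (k == n.-1)).
Proof.
move=> kn; pose q : {poly F} := (t%:P - 'X) ^+ k.
have q1 : q = (-1) ^+ k *: ('X + (- t)%:P) ^+ k.
  by rewrite /q -exprZn scaleN1r polyCN opprB.
have szq : (size q <= n)%N.
  rewrite q1 (leq_trans (size_scale_leq _ _)) //.
  rewrite polyCN -[_ + _]/(_ - _) size_exp_XsubC.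
  by rewrite -(prednK S_gt0) ltnS.
transitivity (divided_difference S (horner q)).
  by apply: eq_bigr => s _; rewrite /q horner_exp hornerD hornerN hornerX hornerC.
rewrite divided_difference_poly // q1 coefZ coef_XaddC_exp.
have [->|ne] := eqVneq k n.-1; first by rewrite subnn binn mulr1.
by rewrite bin_small ?mulr0n ?mulr0 // ltn_neqAle ne.
Qed.


Lemma divided_difference_high t k : t \in T ->
  divided_difference S (fun s => (t - s) ^+ (d + k)) =
  eps * divided_difference S (fun s => (t - s) ^+ k).
Proof.
move=> tT; rewrite /divided_difference mulr_sumr; apply: eq_bigr => s sS.
by rewrite exprD diffE // mulrA.
Qed.

(** The i-th Taylor coefficient at t is a divided difference of (t - s)^(d + n-1-i),
    and the factor (t - s)^d = eps comes out, leaving degree n-1-i. *)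
Lemma stepanov_shift_low t i : t \in T -> (i < n)%N ->
  (stepanov \Po ('X + t%:P))`_i = 0.
Proof.
move=> tT i_lt; rewrite coef_stepanov_shift.
have ile : (i <= n.-1)%N by rewrite -ltnS prednK.
rewrite -addnBA // divided_difference_high // divided_difference_low ?leq_subr //.
have [->|i_neq0] := eqVneq i 0%N.
  by rewrite subn0 eqxx mulr1n bin0 mulr1n mulrC subrr.
suff /negPf-> : (n.-1 - i)%N != n.-1 by rewrite mulr0 mul0rn subr0.
by rewrite ltn_eqF // ltn_subrL lt0n i_neq0 (leq_trans _ ile) // lt0n.
Qed.

Lemma dvdp_Xn (q : {poly F}) k : (forall i, (i < k)%N -> q`_i = 0) -> 'X^k %| q.
Proof.
move=> q0; rewrite -[q](poly_take_drop k) (_ : take_poly k q = 0) ?add0r ?dvdp_mull //.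
by apply/polyP => i; rewrite coef_take_poly coef0; case: ifP => // /q0.
Qed.

Lemma stepanov_mult t : t \in T -> ('X - t%:P) ^+ n %| stepanov.
Proof.
move=> tT; have /dvdp_Xn : forall i, (i < n)%N -> (stepanov \Po ('X + t%:P))`_i = 0.
  by move=> i; apply: stepanov_shift_low.
move/(@dvdp_comp_poly _ ('X - t%:P)); rewrite comp_Xn_poly.
by rewrite comp_polyXaddC_K.
Qed.

Hypothesis d_gt0 : (0 < d)%N.

(** The coefficient of degree i is a divided difference of (-s)^(N - i), which has
    degree less than n - 1 as soon as i > d. *)
Lemma size_stepanov : (size stepanov <= d.+1)%N.
Proof.
apply/leq_sizeP => i di.
have -> : stepanov = stepanov \Po ('X + 0%:P) by rewrite addr0 comp_polyXr.
rewrite coef_stepanov_shift; have [iN|Ni] := leqP i N; last first.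
  by rewrite bin_small // mulr0n sub0r gtn_eqF ?oppr0 // (leq_ltn_trans _ Ni).
have lt_low : (N - i < n.-1)%N by rewrite ltn_subLR // ltn_add2r.
by rewrite divided_difference_low ?(ltnW lt_low) // ltn_eqF // mul0rn gtn_eqF ?subr0 // (leq_ltn_trans _ di).
Qed.

Lemma coef_stepanov : stepanov`_d = (-1) ^+ n.-1 *+ 'C(N, d).
Proof.
have -> : stepanov = stepanov \Po ('X + 0%:P) by rewrite addr0 comp_polyXr.
by rewrite coef_stepanov_shift addKn divided_difference_low // eqxx mulr1n gtn_eqF // subr0.
Qed.

Hypothesis bin_neq0 : 'C(N, d)%:R != 0 :> F.

Lemma stepanov_neq0 : stepanov != 0.
Proof.
have : stepanov`_d != 0 by rewrite coef_stepanov -mulr_natr mulf_neq0 ?signr_eq0.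
by apply: contraNneq => ->; rewrite coef0.
Qed.

Lemma dvdp_rootpoly_exp (q : {poly F}) k : {in T, forall t, ('X - t%:P) ^+ k %| q} ->
  rootpoly T ^+ k %| q.
Proof.
rewrite /rootpoly -big_enum /= => dvd_q.
have {dvd_q} : forall t, t \in enum T -> ('X - t%:P) ^+ k %| q.
  by move=> t; rewrite mem_enum => /dvd_q.
elim: (enum T) (enum_uniq T) => [|t r IHr] /=; first by rewrite big_nil expr1n dvd1p.
case/andP=> tr ur dvd_q; rewrite big_cons exprMn Gauss_dvdp.
  rewrite dvd_q ?mem_head //= IHr // => x xr; apply: dvd_q.
  by rewrite inE xr orbT.
rewrite coprimep_expl // coprimep_expr // coprimep_sym coprimep_XsubC.
by rewrite root_prod_XsubC.
Qed.

Lemma rootpoly_exp_dvd_stepanov : rootpoly T ^+ n %| stepanov.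
Proof. by apply: dvdp_rootpoly_exp => t /stepanov_mult. Qed.

Lemma size_rootpoly_exp : size (rootpoly T ^+ n) = (#|T| * n).+1.
Proof.
have nz : rootpoly T ^+ n != 0 by rewrite expf_neq0 ?rootpoly_neq0.
by rewrite -(prednK (_ : 0 < size _)%N) ?size_poly_gt0 // size_exp size_rootpoly.
Qed.

Lemma stepanov_bound : (#|T| * n <= d)%N.
Proof.
have := dvdp_leq stepanov_neq0 rootpoly_exp_dvd_stepanov.
by rewrite size_rootpoly_exp => /leq_trans /(_ size_stepanov); rewrite ltnS.
Qed.

Lemma stepanov_extremal : (#|T| * n)%N = d ->
  exists2 C, C != 0 & stepanov = C *: rootpoly T ^+ n.
Proof.
move=> dE; have szE : size stepanov = size (rootpoly T ^+ n).
  apply/eqP; rewrite eqn_leq size_rootpoly_exp dE size_stepanov -{1}dE -size_rootpoly_exp.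
  exact: dvdp_leq stepanov_neq0 rootpoly_exp_dvd_stepanov.
have : rootpoly T ^+ n %= stepanov.
  by rewrite -dvdp_size_eqp ?rootpoly_exp_dvd_stepanov // szE.
rewrite eqp_sym => /eqpfP ->.
rewrite (monicP (monic_exp _ (monic_rootpoly T))) divr1.
by exists (lead_coef stepanov); rewrite // lead_coef_eq0 stepanov_neq0.
Qed.

End Stepanov.

(** * Taylor expansions *)

Section Shift.
Variable F : fieldType.
Implicit Types (q : {poly F}) (t : F).
Definition shift t q : {poly F} := q \Po ('X + t%:P).

Lemma shiftM t q1 q2 : shift t (q1 * q2) = shift t q1 * shift t q2.
Proof. exact: rmorphM. Qed.
Lemma shiftD t q1 q2 : shift t (q1 + q2) = shift t q1 + shift t q2.
Proof. exact: rmorphD. Qed.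
Lemma shiftB t q1 q2 : shift t (q1 - q2) = shift t q1 - shift t q2.
Proof. exact: rmorphB. Qed.
Lemma shiftZ t c q : shift t (c *: q) = c *: shift t q.
Proof. exact: linearZ. Qed.
Lemma shift_exp t q k : shift t (q ^+ k) = shift t q ^+ k.
Proof. exact: rmorphXn. Qed.
Lemma shift_deriv t q : shift t q^`() = (shift t q)^`().
Proof. by rewrite /shift deriv_comp derivD derivX derivC addr0 mulr1. Qed.
Lemma shift_coef0 t q : (shift t q)`_0 = q.[t].
Proof. by rewrite -horner_coef0 /shift horner_comp hornerD hornerX hornerC add0r. Qed.
Lemma shift_XsubC t s : shift t ('X - s%:P) = 'X + (t - s)%:P.
Proof. by rewrite /shift rmorphB /= comp_polyX comp_polyC polyCB addrA. Qed.

Lemma coefXaddCM (D : F) (u : {poly F}) i :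
  (('X + D%:P) * u)`_i = (if i == 0%N then 0 else u`_i.-1) + D * u`_i.
Proof. by rewrite mulrDl coefD coefXM coefCM. Qed.

Lemma coefM_low (u v : {poly F}) :
  [/\ (u * v)`_0 = u`_0 * v`_0,
      (u * v)`_1 = u`_0 * v`_1 + u`_1 * v`_0 &
      (u * v)`_2 = u`_0 * v`_2 + u`_1 * v`_1 + u`_2 * v`_0].
Proof.
by split; rewrite coefM !big_ord_recl big_ord0 /= addr0 ?addrA.
Qed.

Lemma coef_deriv_mulrl (u : {poly F}) i : u^`()`_i = i.+1%:R * u`_i.+1.
Proof. by rewrite coef_deriv mulr_natl. Qed.

Lemma deriv_exp_log (u : {poly F}) k : u * (u ^+ k)^`() = (u^`() * u ^+ k) *+ k.
Proof.
case: k => [|k]; first by rewrite derivE mulr0 mulr0n.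
by rewrite deriv_exp mulrnAr mulrCA -exprS.
Qed.

(** Coefficients of u c' = k u' c, the identity satisfied by c = u^k. *)
Lemma expand_exp (u : {poly F}) k :
  let c := u ^+ k in
  [/\ u`_0 * c`_1 = k%:R * (u`_1 * c`_0),
      u`_0 * (2 * c`_2) + u`_1 * c`_1 = k%:R * (u`_1 * c`_1 + 2 * u`_2 * c`_0) &
      u`_0 * (3 * c`_3) + u`_1 * (2 * c`_2) + u`_2 * c`_1
        = k%:R * (u`_1 * c`_2 + 2 * u`_2 * c`_1 + 3 * u`_3 * c`_0)].
Proof.
move=> c; have [e0 e1 e2] := coefM_low u c^`().
have [f0 f1 f2] := coefM_low u^`() c.
have E i : (u * c^`())`_i = k%:R * (u^`() * c)`_i.
  by rewrite /c deriv_exp_log coefMn mulr_natl.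
move: (E 0%N) (E 1%N) (E 2%N); rewrite e0 e1 e2 f0 f1 f2 !coef_deriv_mulrl !mul1r.
by move=> E0 E1 E2; split.
Qed.

End Shift.

Section Normalize.
Variable F : fieldType.

Lemma normalize_reciprocal (g0 g1 g2 g3 s0 s1 s2 s3 : F) : g0 != 0 ->
    g0 * s0 = 1 -> g0 * s1 = g1 * s0 -> g0 * s2 = g1 * s1 - g2 * s0 ->
    g0 * s3 = g1 * s2 - g2 * s1 + g3 * s0 ->
  exists y1 y2 y3 : F,
    [/\ g1 = g0 * y1, g2 = g0 * y2 & g3 = g0 * y3] /\
    [/\ s1 = s0 * y1, s2 = s0 * (y1 ^+ 2 - y2)
       & s3 = s0 * (y1 ^+ 3 - 2 * y1 * y2 + y3)].
Proof.
move=> nz e0 e1 e2 e3.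
have div x : x = g0 * (x / g0) by rewrite mulrC mulfVK.
move: e1 e2 e3; rewrite (div g1) (div g2) (div g3).
move: (g1 / g0) (g2 / g0) (g3 / g0) => y1 y2 y3 e1 e2 e3.
exists y1, y2, y3; split=> //.
have E1 : s1 = s0 * y1 by apply: (mulfI nz); rewrite e1; ring.
have E2 : s2 = s0 * (y1 ^+ 2 - y2) by apply: (mulfI nz); rewrite e2 E1; ring.
by split=> //; apply: (mulfI nz); rewrite e3 E2 E1; ring.
Qed.

Lemma normalize_power (k : F) (p0 p1 p2 p3 c0 c1 c2 c3 : F) : p0 != 0 -> c0 != 0 ->
    p0 * c1 = k * (p1 * c0) ->
    p0 * (2 * c2) + p1 * c1 = k * (p1 * c1 + 2 * p2 * c0) ->
    p0 * (3 * c3) + p1 * (2 * c2) + p2 * c1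
      = k * (p1 * c2 + 2 * p2 * c1 + 3 * p3 * c0) ->
  exists x1 x2 x3 z2 z3 : F,
    [/\ [/\ p1 = p0 * x1, p2 = p0 * x2 & p3 = p0 * x3],
        [/\ c1 = c0 * (k * x1), c2 = c0 * z2 & c3 = c0 * z3],
        2 * z2 + x1 * (k * x1) = k * (x1 * (k * x1) + 2 * x2) &
        3 * z3 + 2 * x1 * z2 + x2 * (k * x1)
          = k * (x1 * z2 + 2 * x2 * (k * x1) + 3 * x3)].
Proof.
move=> nzp nzc; have divp x : x = p0 * (x / p0) by rewrite mulrC mulfVK.
have divc x : x = c0 * (x / c0) by rewrite mulrC mulfVK.
rewrite (divp p1) (divp p2) (divp p3) (divc c1) (divc c2) (divc c3).
move: (p1 / p0) (p2 / p0) (p3 / p0) => x1 x2 x3.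
move: (c1 / c0) (c2 / c0) (c3 / c0) => z1 z2 z3 e1 e2 e3.
have Z1 : z1 = k * x1.
  apply: (mulfI nzp); apply: (mulfI nzc).
  by rewrite mulrCA e1; ring.
exists x1, x2, x3, z2, z3; rewrite -Z1; split=> //.
- apply: (mulfI nzp); apply: (mulfI nzc).
  transitivity (p0 * (2 * (c0 * z2)) + p0 * x1 * (c0 * z1)); first by ring.
  by rewrite e2; ring.
apply: (mulfI nzp); apply: (mulfI nzc).
transitivity (p0 * (3 * (c0 * z3)) + p0 * x1 * (2 * (c0 * z2)) + p0 * x2 * (c0 * z1)); first by ring.
by rewrite e3; ring.
Qed.

(** Here c are the coefficients of phi^n, s those of the reciprocal of g, up to
    signs, and b the binomial coefficients linking them; only ratios of
    consecutive b matter. *)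
Lemma normalize_ratio (k d C c0 c1 c2 c3 s0 s1 s2 s3 : F)
    (b0 b1 b2 b3 z1 z2 z3 w1 w2 w3 : F) :
    C != 0 -> c0 != 0 ->
    [/\ c1 = c0 * z1, c2 = c0 * z2 & c3 = c0 * z3] ->
    [/\ s1 = s0 * w1, s2 = s0 * w2 & s3 = s0 * w3] ->
    [/\ C * c0 = b0 * s0, C * c1 = b1 * s1, C * c2 = b2 * s2 & C * c3 = b3 * s3] ->
    [/\ (k + 1) * b1 = (d - 1) * b0, (k + 2) * b2 = (d - 2) * b1
       & (k + 3) * b3 = (d - 3) * b2] ->
  [/\ (k + 1) * z1 = (d - 1) * w1, (k + 1) * (k + 2) * z2 = (d - 1) * (d - 2) * w2
     & (k + 1) * (k + 2) * (k + 3) * z3 = (d - 1) * (d - 2) * (d - 3) * w3].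
Proof.
move=> nzC nzc [-> -> ->] [-> -> ->] [P0 P1 P2 P3] [B1 B2 B3].
have nz : C * c0 != 0 by rewrite mulf_neq0.
split; apply: (mulfI nz).
- transitivity ((k + 1) * (C * (c0 * z1))); first by ring.
  rewrite P1 mulrA B1 P0; ring.
- transitivity ((k + 1) * (k + 2) * (C * (c0 * z2))); first by ring.
  rewrite P2; transitivity ((k + 1) * ((k + 2) * b2) * (s0 * w2)); first by ring.
  rewrite B2; transitivity ((d - 2) * ((k + 1) * b1) * (s0 * w2)); first by ring.
  by rewrite B1 P0; ring.
transitivity ((k + 1) * (k + 2) * (k + 3) * (C * (c0 * z3))); first by ring.
rewrite P3; transitivity ((k + 1) * (k + 2) * ((k + 3) * b3) * (s0 * w3)); first by ring.
rewrite B3; transitivity ((d - 3) * (k + 1) * ((k + 2) * b2) * (s0 * w3)); first by ring.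
rewrite B2; transitivity ((d - 3) * (d - 2) * ((k + 1) * b1) * (s0 * w3)); first by ring.
by rewrite B1 P0; ring.
Qed.
End Normalize.

(** * Local relations at a point of T *)

Section Local.
Variable F : finFieldType.
Variables (S T : {set F}) (d : nat) (eps : F).
Hypothesis S_gt0 : (0 < #|S|)%N.
Hypothesis eps_neq0 : eps != 0.
Hypothesis diffE : {in T & S, forall t s, (t - s) ^+ d = eps}.
Hypothesis d_gt3 : (3 < d)%N.
Hypothesis TSE : (#|T| * #|S|)%N = d.
Hypothesis nat_neq0 : forall k, (0 < k < d + #|S|)%N -> k%:R != 0 :> F.
Local Notation n := #|S|.
Local Notation N := (d + n.-1)%N.

Lemma bin_natf_neq0 i : (i <= N)%N -> 'C(N, i)%:R != 0 :> F.
Proof.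
have fact_neq0 k : (k <= N)%N -> k`!%:R != 0 :> F.
  elim: k => [|k IHk] kN; first by rewrite oner_neq0.
  rewrite factS natrM mulf_neq0 ?IHk ?(ltnW kN) // nat_neq0 //=.
  by rewrite (leq_ltn_trans kN) // ltn_add2l prednK.
move=> iN; apply: contraNneq (fact_neq0 _ (leqnn N)) => bin0.
by rewrite -(bin_fact iN) natrM bin0 mul0r.
Qed.

Variable t : F.
Hypothesis tT : t \in T.
Let g := shift t (rootpoly S).
Let phi := shift t (rootpoly (T :\ t)).
Let sigma k := divided_difference S (fun s => (t - s)^-1 ^+ k.+1).

Lemma diff_neq0 s : s \in S -> t - s != 0.
Proof.
move=> sS; apply: contraNneq eps_neq0 => ts0.
by rewrite -(diffE tT sS) ts0 expr0n gtn_eqF // (ltn_trans _ d_gt3).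
Qed.

Lemma shift_rootpoly_T : shift t (rootpoly T) = 'X * phi.
Proof. by rewrite (rootpolyD1 tT) shiftM shift_XsubC subrr addr0. Qed.

Lemma phi0_neq0 : phi`_0 != 0.
Proof.
rewrite shift_coef0 -[_ == 0]/(root _ _) rootpoly_root.
by rewrite !inE eqxx.
Qed.

Lemma g0_neq0 : g`_0 != 0.
Proof.
rewrite shift_coef0 -[_ == 0]/(root _ _) rootpoly_root.
by apply/negP => /diff_neq0; rewrite subrr eqxx.
Qed.

(** The sums sigma_i are, up to the sign (-1)^i, the Taylor coefficients of 1/g
    at t, by the partial fraction expansion of 1/g. *)
Lemma sigma_recursion :
  [/\ g`_0 * sigma 0 = 1,
      g`_0 * sigma 1 = g`_1 * sigma 0,
      g`_0 * sigma 2 = g`_1 * sigma 1 - g`_2 * sigma 0 &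
      g`_0 * sigma 3 = g`_1 * sigma 2 - g`_2 * sigma 1 + g`_3 * sigma 0].
Proof.
pose u s := shift t (rootpoly (S :\ s)).
have uE i : divided_difference S (fun s => (u s)`_i) = (i == 0%N)%:R.
  have sz1 : (size (1%R : {poly F}) <= n)%N by rewrite size_poly1.
  have := congr1 (fun q => (shift t q)`_i) (lagrange_interpolation sz1).
  rewrite {2}/shift comp_polyC coefC -[in RHS]mulrb => <-.
  rewrite /shift rmorph_sum coef_sum; apply: eq_bigr => s _ /=.
  by rewrite linearZ coefZ hornerC /= mul1r mulrC.
have gE s i : s \in S ->
    g`_i = (if i == 0%N then 0 else (u s)`_i.-1) + (t - s) * (u s)`_i.
  by move=> sS; rewrite /g (rootpolyD1 sS) shiftM shift_XsubC coefXaddCM.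
have lin (h1 h2 : F -> F) : {in S, h1 =1 h2} -> divided_difference S h1 = divided_difference S h2.
  by move=> h12; apply: eq_bigr => s sS; rewrite h12.
have linD (h1 h2 : F -> F) :
    divided_difference S (fun s => h1 s + h2 s) =
    divided_difference S h1 + divided_difference S h2.
  by rewrite /divided_difference -big_split; apply: eq_bigr => s _; rewrite /= mulrDl.
have linZ (c : F) h : divided_difference S (fun s => c * h s) = c * divided_difference S h.
  by rewrite /divided_difference mulr_sumr; apply: eq_bigr => s _; rewrite mulrA.
have linN h : divided_difference S (fun s => - h s) = - divided_difference S h.
  by rewrite /divided_difference -sumrN; apply: eq_bigr => s _; rewrite mulNr.
have U0 : divided_difference S (fun s => (u s)`_0) = 1 := uE 0%N.
have U1 : divided_difference S (fun s => (u s)`_1) = 0 := uE 1%N.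
have U2 : divided_difference S (fun s => (u s)`_2) = 0 := uE 2%N.
have U3 : divided_difference S (fun s => (u s)`_3) = 0 := uE 3%N.
pose e k s := (t - s)^-1 ^+ k.+1.
have V0 : divided_difference S (fun s => g`_0 * e 0%N s) = 1.
  apply: etrans U0; apply: lin => s sS; rewrite (gE s) // /e /=.
  by field; rewrite diff_neq0.
have V1 : divided_difference S (fun s => g`_1 * e 0%N s + - (g`_0 * e 1%N s)) = 0.
  apply: etrans U1; apply: lin => s sS; rewrite !(gE s) // /e /=.
  by field; rewrite diff_neq0.
have V2 : divided_difference S (fun s => g`_2 * e 0%N s + - (g`_1 * e 1%N s) + g`_0 * e 2%N s) = 0.
  apply: etrans U2; apply: lin => s sS; rewrite !(gE s) // /e /=.
  by field; rewrite diff_neq0.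
have V3 : divided_difference S (fun s =>
    g`_3 * e 0%N s + - (g`_2 * e 1%N s) + g`_1 * e 2%N s + - (g`_0 * e 3%N s)) = 0.
  apply: etrans U3; apply: lin => s sS; rewrite !(gE s) // /e /=.
  by field; rewrite diff_neq0.
move: V0 V1 V2 V3; rewrite !(linD, linN, linZ).
rewrite -/(sigma 0) -/(sigma 1) -/(sigma 2) -/(sigma 3) => V0 V1 V2 V3.
split=> //.
- by apply/esym/eqP; rewrite -subr_eq0 V1.
- by apply/eqP; rewrite -subr_eq0; apply/eqP; apply: etrans V2; ring.
- by apply/esym/eqP; rewrite -subr_eq0; apply/eqP; apply: etrans V3; ring.
Qed.

(** Taylor coefficients of order n + i of P = C f^n at t, with f(t + y) = y phi(y).
    On the side of P, the exponent is d - 1 - i, and (t - s)^d = eps turns it into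
    the negative exponent -1 - i. *)
Lemma power_coef : exists2 C, C != 0 & forall i, (i < d)%N ->
   C * (phi ^+ n)`_i = 'C(N, n + i)%:R * sigma i.
Proof.
have d_gt0 : (0 < d)%N by apply: ltn_trans d_gt3.
have bin_d : 'C(N, d)%:R != 0 :> F by rewrite bin_natf_neq0 // leq_addr.
have [C C0 PE] := stepanov_extremal S_gt0 diffE d_gt0 bin_d TSE.
exists (C / eps) => [|i i_lt]; first by rewrite mulf_neq0 // invr_eq0.
have := congr1 (fun q => (shift t q)`_(n + i)) PE.
rewrite {1}/shift coef_stepanov_shift addn_eq0 gtn_eqF //= subr0.
rewrite shiftZ coefZ shift_exp shift_rootpoly_T exprMn coefXnM ltnNge leq_addr /=.
rewrite addKn => E; rewrite mulrAC -E -[in LHS]mulr_natl -mulrA; congr (_ * _).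
apply: (mulIf eps_neq0); rewrite mulfVK // mulrC /sigma /divided_difference mulr_sumr.
apply: eq_bigr => s sS; rewrite mulrA; congr (_ / _).
have ts0 := diff_neq0 sS.
rewrite -(diffE tT sS).
have -> : (N - (n + i) = d - i.+1)%N.
  by rewrite -{2}(prednK S_gt0) addSn -addnS addnC subnDA addKn.
by rewrite exprVn -{2}(subnK i_lt) exprD mulfK // expf_neq0.
Qed.

(** With phi = phi(0) (1 + x1 y + x2 y^2 + ..) and g = g(0) (1 + y1 y + y2 y^2 + ..)
    near t, the c_i are the coefficients of (1 + x1 y + ..)^n, and the brackets on
    the right are, up to sign, the coefficients of 1 / (1 + y1 y + ..). *)
Lemma local_relations : exists x1 x2 x3 y1 y2 y3 c2 c3 : F,
  [/\ [/\ phi`_1 = phi`_0 * x1, phi`_2 = phi`_0 * x2 & phi`_3 = phi`_0 * x3],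
      [/\ g`_1 = g`_0 * y1, g`_2 = g`_0 * y2 & g`_3 = g`_0 * y3],
      (n%:R + 1) * (n%:R * x1) = (d%:R - 1) * y1,
      [/\ 2 * c2 + x1 * (n%:R * x1) = n%:R * (x1 * (n%:R * x1) + 2 * x2) &
       (n%:R + 1) * (n%:R + 2) * c2 = (d%:R - 1) * (d%:R - 2) * (y1 ^+ 2 - y2)] &
      [/\ 3 * c3 + 2 * x1 * c2 + x2 * (n%:R * x1) =
         n%:R * (x1 * c2 + 2 * x2 * (n%:R * x1) + 3 * x3) &
       (n%:R + 1) * (n%:R + 2) * (n%:R + 3) * c3 =
        (d%:R - 1) * (d%:R - 2) * (d%:R - 3) * (y1 ^+ 3 - 2 * y1 * y2 + y3)]].
Proof.
have [C C0 PC] := power_coef.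
have [s0 s1 s2 s3] := sigma_recursion.
have [e1 e2 e3] := expand_exp phi n.
have c0 : (phi ^+ n)`_0 != 0.
  by rewrite -horner_coef0 horner_exp expf_neq0 // horner_coef0 phi0_neq0.
have step k : (k.+1 < d)%N ->
    (n%:R + k.+1%:R) * 'C(N, n + k.+1)%:R = (d%:R - k.+1%:R) * 'C(N, n + k)%:R :> F.
  move=> kd; rewrite -natrD -natrB ?(ltnW kd) // -!natrM addnS mul_bin_left.
  by congr (_ * _)%:R; rewrite -{2}(prednK S_gt0) addSn -addnS addnC subnDA addKn.
have d1 : (1 < d)%N by apply: ltn_trans d_gt3.
have d2 : (2 < d)%N by apply: ltn_trans d_gt3.
have [y1 [y2 [y3 [Y]]]] := normalize_reciprocal g0_neq0 s0 s1 s2 s3.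
set w2 := _ - _; set w3 := _ + _ => W.
have [x1 [x2 [x3 [c2 [c3 [X Z E1 E2]]]]]] := normalize_power phi0_neq0 c0 e1 e2 e3.
have [T1 T2 T3] := normalize_ratio C0 c0 Z W
  (And4 (PC 0%N (ltnW d1)) (PC 1%N d1) (PC 2%N d2) (PC 3%N d_gt3))
  (And3 (step 0%N d1) (step 1%N d2) (step 2%N d_gt3)).
by exists x1, x2, x3, y1, y2, y3, c2, c3; split; rewrite -?E1.
Qed.
End Local.

(** * Elimination in the square case *)

(** In this section n is the image in F of the common cardinal of S and T.  The
    hypotheses L1, L2c, L2, L3c, L3 are the local relations, R2 and R3 the next
    two Taylor coefficients of the differential equation, and W3 that of the
    skew identity.  The latter is available only once [skew_form_local] has
    been used at all the points of S and T. *)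
Section Obstruction.
Variables (F : fieldType) (n : F).
Definition order2_lcoef := 3 * n ^+ 3 - 2 * n ^+ 2 - 6 * n + 2.
Definition order2_rcoef := (n - 1) * (n + 1) * (3 * n - 2).
Definition quad_factor := 3 * n ^+ 2 + 4 * n - 1.
Definition skew_coef := - 3 * (3 * n ^+ 3 - 2 * n ^+ 2 - 5 * n + 2).
Definition quart_factor := 3 * n ^+ 4 + 5 * n ^+ 3 - 2 * n ^+ 2 - 5 * n + 2.
Hypotheses (n0 : n != 0) (n1 : n + 1 != 0) (two : 2 != 0 :> F) (three : 3 != 0 :> F).
Variables (x1 x2 x3 y1 y2 y3 c2 c3 : F).
Hypothesis L1 : (n + 1) * (n * x1) = (n * n - 1) * y1.
Hypothesis L2c : 2 * c2 + x1 * (n * x1) = n * (x1 * (n * x1) + 2 * x2).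
Hypothesis L2 : (n + 1) * (n + 2) * c2 = (n * n - 1) * (n * n - 2) * (y1 ^+ 2 - y2).
Hypothesis R2 : n * (6 * x2 + 2 * x1 * y1) - 2 * (n - 1) * (2 * y2 + 2 * x1 * y1)
  + n * (2 * y2) = 0.

Lemma order1_relation : n * x1 = (n - 1) * y1.
Proof. by apply: (mulfI n1); rewrite L1; ring. Qed.

Lemma order2_ode_relation : 3 * n * x2 = (n - 2) * (y2 + x1 * y1).
Proof.
apply: (mulfI two); apply/eqP; rewrite -subr_eq0; apply/eqP.
by rewrite -[RHS]R2; ring.
Qed.

(** Both R2 and L2 relate x2, y2 and y1^2; eliminating x2 determines y2. *)
Lemma order2_relation : 2 * order2_lcoef * y2 = order2_rcoef * (x1 * y1).
Proof.
have c2E : (n + 2) * c2 = (n - 1) * (n * n - 2) * (y1 ^+ 2 - y2).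
  by apply: (mulfI n1); rewrite mulrA L2; ring.
have A : (n + 2) * (2 * n * x2 + n * (n - 1) * x1 ^+ 2)
    = 2 * ((n - 1) * (n * n - 2) * (y1 ^+ 2 - y2)).
  rewrite -c2E; have -> : 2 * n * x2 + n * (n - 1) * x1 ^+ 2 = 2 * c2.
    have -> : 2 * c2 = 2 * c2 + x1 * (n * x1) - x1 * (n * x1) by ring.
    by rewrite L2c; ring.
  by ring.
have B : (n - 1) * y1 ^+ 2 = n * (x1 * y1) by rewrite expr2 mulrA -order1_relation; ring.
have C : n * (n - 1) * x1 ^+ 2 = (n - 1) ^+ 2 * (x1 * y1).
  transitivity ((n - 1) * x1 * (n * x1)); first by ring.
  by rewrite order1_relation; ring.
have D : 3 * ((n + 2) * (2 * n * x2 + n * (n - 1) * x1 ^+ 2))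
   = 2 * (n + 2) * (3 * n * x2) + 3 * (n + 2) * (n * (n - 1) * x1 ^+ 2) by ring.
move: D; rewrite A order2_ode_relation C.
have -> : 3 * (2 * ((n - 1) * (n * n - 2) * (y1 ^+ 2 - y2)))
   = 6 * (n * n - 2) * ((n - 1) * y1 ^+ 2 - (n - 1) * y2) by ring.
rewrite B => D; apply/eqP; rewrite -subr_eq0; apply/eqP.
rewrite /order2_lcoef /order2_rcoef; move/eqP: D; rewrite -subr_eq0 => /eqP D.
by rewrite -[RHS]oppr0 -D; ring.
Qed.

(** The coefficients n (3n^2+4n-1) and [skew_coef] are the ones for which this
    combination is a multiple of the order 2 relation while being the value at t
    of a form that is skew in f and g. *)
Lemma skew_form_local : - 6 * (n * quad_factor) * x2 + skew_coef * (2 * y2 - 2 * x1 * y1) = 0.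
Proof.
transitivity (- 2 * quad_factor * (3 * n * x2) + skew_coef * (2 * y2 - 2 * x1 * y1)); first by ring.
rewrite order2_ode_relation.
transitivity (4 * (order2_rcoef * (x1 * y1) - 2 * order2_lcoef * y2)).
  by rewrite /quad_factor /skew_coef /order2_rcoef /order2_lcoef; ring.
by rewrite order2_relation subrr mulr0.
Qed.

Hypothesis L3c : 3 * c3 + 2 * x1 * c2 + x2 * (n * x1) =
         n * (x1 * c2 + 2 * x2 * (n * x1) + 3 * x3).
Hypothesis L3 : (n + 1) * (n + 2) * (n + 3) * c3 =
        (n * n - 1) * (n * n - 2) * (n * n - 3) * (y1 ^+ 3 - 2 * y1 * y2 + y3).
Hypothesis R3 : n * (12 * x3 + 6 * x2 * y1 + 2 * x1 * y2)
  - 2 * (n - 1) * (3 * y3 + 4 * x1 * y2 + 3 * x2 * y1) + n * (6 * y3 + 2 * x1 * y2) = 0.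
Hypothesis W3 : n * quad_factor * (6 * y3 - 24 * x3 - 6 * x2 * y1)
  + skew_coef * (6 * y3 - 6 * x2 * y1) = 0.

(** Substituting the order 1 and order 2 relations, and R3 for x3, leaves two linear
    equations in y3, from L3 and from W3.  Their resultant is homogeneous of
    weight 3, hence a multiple of y1^3. *)
Lemma order3_obstruction : y1 != 0 -> n - 1 != 0 -> (n - 2) * quad_factor * quart_factor = 0.
Proof.
move=> y0 nm1.
(* Otherwise 3n = 2 as well, and then 9 [order2_lcoef] = -18. *)
have U0 : order2_lcoef != 0.
  apply/eqP => U0; have := order2_relation; rewrite U0 mulr0 mul0r => /esym/eqP.
  have x10 : x1 != 0.
    by apply: contra_eq_neq order1_relation => ->; rewrite mulr0 eq_sym mulf_neq0.
  rewrite !mulf_eq0 (negPf x10) (negPf y0) (negPf nm1) (negPf n1) !orbF /=.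
  rewrite subr_eq0 => /eqP T0.
  have : 9 * order2_lcoef = 3 * n * (3 * n) * (3 * n) - 2 * (3 * n) * (3 * n) - 18 * (3 * n) + 18.
    by rewrite /order2_lcoef; ring.
  rewrite U0 mulr0 T0 => /esym E.
  have /eqP : 2 * (3 * 3) = 0 :> F by rewrite -[RHS]oppr0 -E; ring.
  by rewrite !mulf_eq0 (negPf two) (negPf three).
have X1 : x1 = (n - 1) * y1 / n by rewrite -order1_relation mulrC mulKf.
have Y2 : y2 = order2_rcoef * (x1 * y1) / (2 * order2_lcoef).
  by rewrite -order2_relation mulrC mulKf // mulf_neq0.
have X2 : x2 = (n - 2) * (y2 + x1 * y1) / (3 * n).
  by rewrite -order2_ode_relation mulrC mulKf // mulf_neq0.
have six : 6 = 2 * 3 :> F by ring.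
have six0 : 6 != 0 :> F by rewrite six mulf_neq0.
have X3 : x3 = - (3 * y3 + 3 * x2 * y1 - 2 * (n - 2) * x1 * y2) / (6 * n).
  apply: (mulfI (mulf_neq0 six0 n0)); rewrite mulrC [RHS]mulrC mulfVK ?mulf_neq0 //.
  apply: (mulfI two); apply/eqP; rewrite -subr_eq0; apply/eqP.
  by rewrite -[RHS]R3; ring.
have c2E : (n + 2) * c2 = (n - 1) * (n * n - 2) * (y1 ^+ 2 - y2).
  by apply: (mulfI n1); rewrite mulrA L2; ring.
have c3E : (n + 2) * (n + 3) * c3 =
    (n - 1) * (n * n - 2) * (n * n - 3) * (y1 ^+ 3 - 2 * y1 * y2 + y3).
  by apply: (mulfI n1); rewrite !mulrA L3; ring.
have L : 3 * ((n - 1) * (n * n - 2) * (n * n - 3) * (y1 ^+ 3 - 2 * y1 * y2 + y3))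
    + (2 - n) * x1 * (n + 3) * ((n - 1) * (n * n - 2) * (y1 ^+ 2 - y2))
    + (n + 2) * (n + 3) * (n * x1 * x2 - 2 * n * n * x1 * x2 - 3 * n * x3) = 0.
  rewrite -c2E -c3E.
  have -> : n * x1 * x2 = (3 * c3 + 2 * x1 * c2 + x2 * (n * x1)) - 3 * c3 - 2 * x1 * c2 by ring.
  by rewrite L3c; ring.
have E : n * quad_factor * (y3 - 4 * x3 - x2 * y1) + skew_coef * (y3 - x2 * y1) = 0.
  by apply: (mulfI six0); rewrite mulr0 -[RHS]W3; ring.
suff : 2 * ((n - 1) * (n - 1)) * ((n - 2) * quad_factor * quart_factor) * y1 ^+ 3 = 0.
  have K0 : 2 * ((n - 1) * (n - 1)) * y1 ^+ 3 != 0 by rewrite !mulf_neq0 ?expf_neq0.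
  by move=> H; apply: (mulfI K0); rewrite mulr0 -[RHS]H; ring.
(* M and A are the coefficients of y3 in the equations E and L, so that it cancels
   in M L - A E. *)
pose M := n * quad_factor + skew_coef + 2 * quad_factor.
pose A := 3 * (n - 1) * (n * n - 2) * (n * n - 3) + 3 / 2 * (n + 2) * (n + 3).
transitivity (- (n * order2_lcoef) *
  (M * (3 * ((n - 1) * (n * n - 2) * (n * n - 3) * (y1 ^+ 3 - 2 * y1 * y2 + y3))
    + (2 - n) * x1 * (n + 3) * ((n - 1) * (n * n - 2) * (y1 ^+ 2 - y2))
    + (n + 2) * (n + 3) * (n * x1 * x2 - 2 * n * n * x1 * x2 - 3 * n * x3))
   - A * (n * quad_factor * (y3 - 4 * x3 - x2 * y1) + skew_coef * (y3 - x2 * y1)))); last first.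
  by rewrite L E !mulr0 subr0 mulr0.
rewrite X3 X2 Y2 X1 /M /A /quart_factor.
move: U0; rewrite /order2_rcoef /quad_factor /skew_coef /order2_lcoef => U0.
by field; rewrite ?U0 ?two ?three ?n0.
Qed.

End Obstruction.

(** * Global differential identities *)

Section Extremal.
Variable F : finFieldType.

(** An extremal configuration for Stepanov's bound.  Allowing any eps instead of 1
    makes the notion symmetric in S and T: exchanging them multiplies t - s by -1.
    The last field says that the characteristic is at least 2d. *)
Record extremal (S T : {set F}) (d : nat) (eps : F) : Prop := Extremal {
  ext_S : (1 < #|S|)%N;
  ext_T : (1 < #|T|)%N;
  ext_card : (#|T| * #|S|)%N = d;
  ext_d : (3 < d)%N;
  ext_eps : eps != 0;
  ext_diff : {in T & S, forall t s, (t - s) ^+ d = eps};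
  ext_nat : forall k, (0 < k < d + d)%N -> k%:R != 0 :> F }.

Lemma extremal_sym S T d eps :
  extremal S T d eps -> extremal T S d ((-1) ^+ d * eps).
Proof.
case=> S1 T1 ST d3 e0 diff nat0; split=> //; first by rewrite mulnC.
  by rewrite mulf_neq0 ?signr_eq0.
by move=> s t sS tT; rewrite -(diff t s) // -exprMn mulN1r opprB.
Qed.

Lemma size_deriv_le (q : {poly F}) k : (size q <= k.+1)%N -> (size q^`() <= k)%N.
Proof. by move=> szq; rewrite (leq_trans (size_poly _ _)) //; lia. Qed.

Lemma size_mul_le (q1 q2 : {poly F}) k1 k2 k :
  (size q1 <= k1)%N -> (size q2 <= k2)%N -> (k1 + k2 <= k.+1)%N -> (size (q1 * q2)%R <= k)%N.
Proof. by move=> s1 s2 kk; rewrite (leq_trans (size_polyMleq q1 q2)) //; lia. Qed.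

Section Pair.
Variables (S T : {set F}) (d : nat) (eps : F).
Hypothesis ext : extremal S T d eps.
Local Notation n := #|S|.
Local Notation m := #|T|.
Local Notation g := (rootpoly S).
Local Notation f := (rootpoly T).

Lemma card_lt_product : (n < d)%N /\ (m < d)%N.
Proof. have := ext_card ext; have := ext_S ext; have := ext_T ext; nia. Qed.

Lemma nat_neq0S k : (0 < k < d + n)%N -> k%:R != 0 :> F.
Proof.
move=> /andP[k0 kd]; rewrite (ext_nat ext) // k0 (leq_trans kd) //.
by rewrite leq_add2l ltnW // (card_lt_product).1.
Qed.

Lemma two_neq0 : 2 != 0 :> F.
Proof. by rewrite (ext_nat ext) //; have := ext_d ext; lia. Qed.
Lemma three_neq0 : 3 != 0 :> F.
Proof. by rewrite (ext_nat ext) //; have := ext_d ext; lia. Qed.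

Lemma disjoint_ST : [disjoint S & T].
Proof.
apply/pred0P => x /=; apply/negP => /andP[xS xT].
have := ext_diff ext xT xS; rewrite subrr expr0n gtn_eqF ?(ltn_trans _ (ext_d ext)) //.
by move=> e0; have := ext_eps ext; rewrite -e0 eqxx.
Qed.

Lemma poly_eq0_ST (q : {poly F}) : (size q <= n + m)%N ->
  {in S, forall s, q.[s] = 0} -> {in T, forall t, q.[t] = 0} -> q = 0.
Proof.
move=> szq qS qT; apply: (@poly_eq0_on _ (S :|: T)) => [|x].
  by have := disjoint_ST; rewrite -setI_eq0 => /eqP ST; rewrite cardsU ST cards0 subn0.
by rewrite inE => /orP[/qS|/qT].
Qed.

Definition local_expansion t := local_relations (ltnW (ext_S ext)) (ext_eps ext) (ext_diff ext)
  (ext_d ext) (ext_card ext) nat_neq0S (t := t).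

Definition ode : {poly F} :=
  (n%:R * (n%:R + 1)) *: (f^`()^`() * g) - (2 * (d%:R - 1)) *: (f^`() * g^`())
  + (m%:R * (m%:R + 1)) *: (g^`()^`() * f).

Lemma ode_at_T : {in T, forall t, ode.[t] = 0}.
Proof.
move=> t tT; have [x1 [x2 [x3 [y1 [y2 [y3 [c2 [c3 [X Y L1 _ _]]]]]]]]] := local_expansion tT.
rewrite -shift_coef0 /ode !(shiftD, shiftZ, shiftM, shift_deriv) -scaleNr shiftZ.
rewrite shiftM !shift_deriv (shift_rootpoly_T tT) !coefD !coefZ.
move: (shift t (rootpoly (T :\ t))) (shift t g) X Y => phi h [X1 _ _] [Y1 _ _].
have [e1 _ _] := coefM_low ('X * phi)^`()^`() h.
have [e2 _ _] := coefM_low ('X * phi)^`() h^`().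
have [e3 _ _] := coefM_low h^`()^`() ('X * phi).
rewrite e1 e2 e3 !coef_deriv !coefXM /= !mulr1n X1 Y1.
transitivity (2 * phi`_0 * h`_0 * ((n%:R + 1) * (n%:R * x1) - (d%:R - 1) * y1)).
  by ring.
by rewrite L1 subrr mulr0.
Qed.

End Pair.

Section Identities.
Variables (S T : {set F}) (d : nat) (eps : F).
Hypothesis ext : extremal S T d eps.
Local Notation n := #|S|.
Local Notation m := #|T|.
Local Notation g := (rootpoly S).
Local Notation f := (rootpoly T).

Lemma ode_sym : ode S T d = ode T S d.
Proof. by rewrite /ode [f^`() * _]mulrC addrC addrA addrAC. Qed.

(** The left side vanishes on T by the first order local relation, on S by symmetry,
    and has degree at most n + m - 2. *)
Lemma ode_eq0 : ode S T d = 0.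
Proof.
apply: (poly_eq0_ST ext); last exact: ode_at_T ext.
  have := ext_S ext; have := ext_T ext => m1 n1.
  have sf : (size f <= m.-1.+1.+1)%N by rewrite size_rootpoly; lia.
  have sg : (size g <= n.-1.+1.+1)%N by rewrite size_rootpoly; lia.
  have sf1 := size_deriv_le sf; have sg1 := size_deriv_le sg.
  have sf2 := size_deriv_le sf1; have sg2 := size_deriv_le sg1.
  rewrite /ode (leq_trans (size_polyD _ _)) // geq_max (leq_trans (size_polyD _ _)).
    rewrite (leq_trans (size_scale_leq _ _)) //.
    by rewrite (size_mul_le sg2 sf) //; lia.
  rewrite geq_max size_polyN !(leq_trans (size_scale_leq _ _)) //.
    by rewrite (size_mul_le sf1 sg1) //; lia.
  by rewrite (size_mul_le sf2 sg) //; lia.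
by rewrite ode_sym; apply: ode_at_T (extremal_sym ext).
Qed.

End Identities.

Section Square.
Variables (S T : {set F}) (d : nat) (eps : F).
Hypothesis ext : extremal S T d eps.
Hypothesis TS : #|T| = #|S|.
Local Notation n := #|S|.
Local Notation nF := (#|S|%:R : F).
Local Notation g := (rootpoly S).
Local Notation f := (rootpoly T).

Lemma cardS_add_neq0 k : (k < 4)%N -> nF + k%:R != 0.
Proof.
move=> k4; rewrite -natrD (ext_nat ext) //.
have := ext_card ext; rewrite TS; have := ext_S ext; nia.
Qed.

Lemma cardS_sub_neq0 k : (k < n)%N -> nF - k%:R != 0.
Proof.
move=> kn; rewrite -natrB ?(ltnW kn) // (ext_nat ext) //.
have := ext_card ext; rewrite TS; nia.
Qed.

Definition skew_form (p q : {poly F}) : {poly F} :=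
  (nF * quad_factor nF) *: (p^`()^`()^`() * q - p * q^`()^`()^`())
  + skew_coef nF *: (p^`()^`() * q^`() - p^`() * q^`()^`()).

Lemma skew_formC p q : skew_form p q = - skew_form q p.
Proof.
rewrite /skew_form opprD -!scalerN !opprB; congr (_ *: (_ - _) + _ *: (_ - _)); exact: mulrC.
Qed.

(** For n = m and d = n^2, all coefficients of the differential equation are multiples
    of n + 1, which is divided out. *)
Lemma local_square t : t \in T -> exists x1 x2 x3 y1 y2 y3 c2 c3 : F,
  let h := shift t g in let phi := shift t (rootpoly (T :\ t)) in
  [/\ [/\ phi`_1 = phi`_0 * x1, phi`_2 = phi`_0 * x2 & phi`_3 = phi`_0 * x3],
      [/\ h`_1 = h`_0 * y1, h`_2 = h`_0 * y2 & h`_3 = h`_0 * y3],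
      (nF + 1) * (nF * x1) = (nF * nF - 1) * y1,
      [/\ 2 * c2 + x1 * (nF * x1) = nF * (x1 * (nF * x1) + 2 * x2),
       (nF + 1) * (nF + 2) * c2 = (nF * nF - 1) * (nF * nF - 2) * (y1 ^+ 2 - y2) &
       nF * (6 * x2 + 2 * x1 * y1) - 2 * (nF - 1) * (2 * y2 + 2 * x1 * y1)
         + nF * (2 * y2) = 0] &
      [/\ 3 * c3 + 2 * x1 * c2 + x2 * (nF * x1) =
         nF * (x1 * c2 + 2 * x2 * (nF * x1) + 3 * x3),
       (nF + 1) * (nF + 2) * (nF + 3) * c3 =
        (nF * nF - 1) * (nF * nF - 2) * (nF * nF - 3) * (y1 ^+ 3 - 2 * y1 * y2 + y3) &
       nF * (12 * x3 + 6 * x2 * y1 + 2 * x1 * y2)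
         - 2 * (nF - 1) * (3 * y3 + 4 * x1 * y2 + 3 * x2 * y1)
         + nF * (6 * y3 + 2 * x1 * y2) = 0]].
Proof.
move=> tT; have [x1 [x2 [x3 [y1 [y2 [y3 [c2 [c3]]]]]]]] := local_expansion ext tT.
have dE : d%:R = nF * nF by rewrite -natrM -{1}TS (ext_card ext).
rewrite dE => -[X Y L1 [L2c L2] [L3c L3]].
exists x1, x2, x3, y1, y2, y3, c2, c3; cbv zeta.
have h0 : (shift t g)`_0 != 0 := g0_neq0 (ext_eps ext) (ext_diff ext) (ext_d ext) tT.
have p0 : (shift t (rootpoly (T :\ t)))`_0 != 0 := phi0_neq0 T t.
have n1 : nF + 1 != 0 := cardS_add_neq0 (isT : 1 < 4)%N.
have := congr1 (shift t) (ode_eq0 ext).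
rewrite /ode -scaleNr !(shiftD, shiftZ, shiftM, shift_deriv) (shift_rootpoly_T tT).
rewrite TS dE [shift t 0]rmorph0.
move: (shift t (rootpoly (T :\ t))) (shift t g) X Y h0 p0 => phi h X Y h0 p0 O.
have [_ e1 e1'] := coefM_low ('X * phi)^`()^`() h.
have [_ e2 e2'] := coefM_low ('X * phi)^`() h^`().
have [_ e3 e3'] := coefM_low h^`()^`() ('X * phi).
have O1 := congr1 (fun q : {poly F} => q`_1) O.
have O2 := congr1 (fun q : {poly F} => q`_2) O.
move: O1 O2 {O}; rewrite /= !coefD !coefZ e1 e2 e3 e1' e2' e3' !coef_deriv_mulrl !coefXM /= !coef0.
clear e1 e2 e3 e1' e2' e3'; move: X Y => [-> -> ->] [-> -> ->] O1 O2.
have nz : (nF + 1) * h`_0 * phi`_0 != 0 by rewrite !mulf_neq0.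
split=> //; split=> //; apply: (mulfI nz); rewrite mulr0.
  by rewrite -[RHS]O1; ring.
by rewrite -[RHS]O2; ring.
Qed.

Lemma skew_form_at_T : {in T, forall t, (skew_form g f).[t] = 0}.
Proof.
move=> t tT; have [x1 [x2 [x3 [y1 [y2 [y3 [c2 [c3]]]]]]]] := local_square tT.
move=> /= [X Y L1 [L2c L2 R2] _].
have n1 : nF + 1 != 0 := cardS_add_neq0 (isT : 1 < 4)%N.
have W := skew_form_local n1 (two_neq0 ext) L1 L2c L2 R2.
rewrite -shift_coef0 /skew_form !(shiftB, shiftD, shiftZ, shiftM, shift_deriv).
rewrite (shift_rootpoly_T tT).
move: (shift t (rootpoly (T :\ t))) (shift t g) X Y => phi h [X1 X2 _] [Y1 Y2 _].
have [e1 _ _] := coefM_low h^`()^`()^`() ('X * phi).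
have [e2 _ _] := coefM_low h ('X * phi)^`()^`()^`().
have [e3 _ _] := coefM_low h^`()^`() ('X * phi)^`().
have [e4 _ _] := coefM_low h^`() ('X * phi)^`()^`().
rewrite !(coefD, coefN, coefZ) e1 e2 e3 e4 !coef_deriv_mulrl !coefXM /= X1 X2 Y1 Y2.
transitivity (h`_0 * phi`_0 *
  (- 6 * (nF * quad_factor nF) * x2 + skew_coef nF * (2 * y2 - 2 * x1 * y1))); first by ring.
by rewrite W mulr0.
Qed.

End Square.

Section SquareGlobal.
Variables (S T : {set F}) (d : nat) (eps : F).
Hypothesis ext : extremal S T d eps.
Hypothesis TS : #|T| = #|S|.
Local Notation n := #|S|.
Local Notation nF := (#|S|%:R : F).
Local Notation g := (rootpoly S).
Local Notation f := (rootpoly T).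

(** The order 2 relation at T and, as the form changes sign when f and g are
    exchanged, at S gives n + m roots, more than the degree. *)
Lemma skew_form_eq0 : skew_form S g f = 0.
Proof.
apply: (poly_eq0_ST ext); last exact: skew_form_at_T ext TS.
  have := ext_S ext => n1; rewrite TS.
  have sf : (size f <= n.-2.+3)%N by rewrite size_rootpoly TS; lia.
  have sg : (size g <= n.-2.+3)%N by rewrite size_rootpoly; lia.
  have sf1 := size_deriv_le sf; have sg1 := size_deriv_le sg.
  have sf2 := size_deriv_le sf1; have sg2 := size_deriv_le sg1.
  have sf3 := size_deriv_le (leq_trans sf2 (leqnSn _)).
  have sg3 := size_deriv_le (leq_trans sg2 (leqnSn _)).
  rewrite /skew_form (leq_trans (size_polyD _ _)) // geq_max.
  rewrite !(leq_trans (size_scale_leq _ _)) // (leq_trans (size_polyD _ _)) // geq_max size_polyN.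
    by rewrite (size_mul_le sg2 sf1) ?(size_mul_le sg1 sf2) //; lia.
  by rewrite (size_mul_le sg3 sf) ?(size_mul_le sg sf3) //; lia.
move=> s sS; rewrite skew_formC hornerN /skew_form -TS.
have ST : #|S| = #|T| by [].
by rewrite -/(skew_form T f g) (skew_form_at_T (extremal_sym ext)) ?oppr0.
Qed.

(** The skew identity holds everywhere, so its next Taylor coefficient at t is one more
    relation, independent of the local ones; y1 = g'(t) / g(t) must be nonzero for
    it to be of use. *)
Theorem square_obstruction :
  (nF - 2) * quad_factor nF * quart_factor nF = 0.
Proof.
(* g' has degree n - 1, so it cannot vanish at all n points of T. *)
have [t tT y1t] : exists2 t, t \in T & g^`().[t] != 0.
  apply/exists_inP; apply: contraT; rewrite negb_exists_in => /forall_inP gt0.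
  have g0 : g^`() = 0.
    apply: (@poly_eq0_on _ T) => [|t /gt0/negPn/eqP//].
    by rewrite TS size_deriv_le // size_rootpoly.
  have : g^`()`_n.-1 != 0.
    have n0 : (0 < n)%N := ltnW (ext_S ext).
    rewrite coef_deriv prednK //.
    have -> : g`_n = 1.
      by have := monicP (monic_rootpoly S); rewrite /lead_coef size_rootpoly.
    by have := cardS_add_neq0 ext TS (isT : 0 < 4)%N; rewrite addr0.
  by rewrite g0 coef0 eqxx.
have [x1 [x2 [x3 [y1 [y2 [y3 [c2 [c3]]]]]]]] := local_square ext TS tT.
move=> /= [X Y L1 [L2c L2 R2] [L3c L3 R3]].
have h0 : (shift t g)`_0 != 0 := g0_neq0 (ext_eps ext) (ext_diff ext) (ext_d ext) tT.
have p0 : (shift t (rootpoly (T :\ t)))`_0 != 0 := phi0_neq0 T t.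
have n0 : nF != 0 by have := cardS_add_neq0 ext TS (isT : 0 < 4)%N; rewrite addr0.
have n1 : nF + 1 != 0 := cardS_add_neq0 ext TS (isT : 1 < 4)%N.
have nm1 : nF - 1 != 0 := cardS_sub_neq0 ext TS (ext_S ext).
have y0 : y1 != 0.
  apply: contraNneq y1t => y0; case: Y => Y1 _ _; rewrite -shift_coef0 shift_deriv.
  by rewrite coef_deriv_mulrl Y1 y0 !mulr0.
suff W3 : nF * quad_factor nF * (6 * y3 - 24 * x3 - 6 * x2 * y1)
    + skew_coef nF * (6 * y3 - 6 * x2 * y1) = 0.
  exact: (order3_obstruction n0 n1 (two_neq0 ext) (three_neq0 ext) L1 L2c L2 R2 L3c L3 R3 W3 y0 nm1).
have := congr1 (shift t) skew_form_eq0.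
rewrite /skew_form !(shiftB, shiftD, shiftZ, shiftM, shift_deriv) (shift_rootpoly_T tT).
rewrite [shift t 0]rmorph0.
move: (shift t (rootpoly (T :\ t))) (shift t g) X Y h0 p0 => phi h X Y h0 p0 O.
have [_ e1 _] := coefM_low h^`()^`()^`() ('X * phi).
have [_ e2 _] := coefM_low h ('X * phi)^`()^`()^`().
have [_ e3 _] := coefM_low h^`()^`() ('X * phi)^`().
have [_ e4 _] := coefM_low h^`() ('X * phi)^`()^`().
have := congr1 (fun q : {poly F} => q`_1) O.
rewrite /= !(coefD, coefN, coefZ) e1 e2 e3 e4 !coef_deriv_mulrl !coefXM /= coef0.
clear e1 e2 e3 e4 O; move: X Y => [-> -> ->] [-> -> ->] O.
have nz : h`_0 * phi`_0 != 0 by rewrite mulf_neq0.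
by apply: (mulfI nz); rewrite mulr0 -[RHS]O; ring.
Qed.

End SquareGlobal.

End Extremal.

(** * Power sums and equality of the two cardinals *)

Section PowerSums.
Variable F : finFieldType.
Implicit Types (S T : {set F}) (x tau : F).

Definition psum tau S k : F := \sum_(s in S) (s - tau) ^+ k.

Lemma psum0 tau S : psum tau S 0 = #|S|%:R.
Proof. by rewrite /psum (eq_bigr (fun=> 1)) // sumr_const. Qed.

Lemma log_deriv_rootpoly S x : x \notin S ->
  (rootpoly S)^`().[x] = (rootpoly S).[x] * \sum_(s in S) (x - s)^-1.
Proof.
rewrite /rootpoly -!big_enum /= -mem_enum.
elim: (enum S) => [|s r IHr]; first by rewrite !big_nil derivE horner0 mulr0.
rewrite inE negb_or => /andP[xs xr]; rewrite !big_cons derivM derivXsubC mul1r.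
rewrite hornerD !hornerM hornerXsubC IHr // mulrDr mulrAC mulfV ?subr_eq0 // mul1r.
by rewrite mulrA.
Qed.

Definition complete_sym2 k (x y : F) : F := \sum_(i < k.+1) x ^+ (k - i) * y ^+ i.

Lemma sum_complete_sym2 tau S T k :
  \sum_(t in T) \sum_(s in S) complete_sym2 k (t - tau) (s - tau)
    = \sum_(i < k.+1) psum tau T (k - i) * psum tau S i.
Proof.
rewrite /complete_sym2; under eq_bigr do rewrite exchange_big /=.
rewrite exchange_big /=; apply: eq_bigr => i _.
by rewrite /psum mulr_suml; apply: eq_bigr => t _; rewrite mulr_sumr.
Qed.

Lemma complete_sym2_diff k x y : x != y -> complete_sym2 k x y = (x ^+ k.+1 - y ^+ k.+1) / (x - y).
Proof.
by move=> xy; rewrite subrXX mulrC mulKf ?subr_eq0 //.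
Qed.

Lemma complete_sym2_diag k x : complete_sym2 k x x = k.+1%:R * x ^+ k.
Proof.
rewrite /complete_sym2 (eq_bigr (fun=> x ^+ k)) => [|i _]; last by rewrite -exprD subnK // -ltnS.
by rewrite sumr_const card_ord mulr_natl.
Qed.

(** Symmetrising in t and t' replaces t^(k+1) / (t - t') by half of the quotient
    (t^(k+1) - t'^(k+1)) / (t - t'), a polynomial; the last term is the diagonal. *)
Lemma self_interaction tau T k :
  2 * \sum_(t in T) (t - tau) ^+ k.+1 * \sum_(t' in T :\ t) (t - t')^-1
    = (\sum_(i < k.+1) psum tau T (k - i) * psum tau T i) - k.+1%:R * psum tau T k.
Proof.
rewrite -sum_complete_sym2 /psum [X in _ = _ - X]mulr_sumr -sumrB.
pose G t t' := (t - tau) ^+ k.+1 / (t - t').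
have -> : \sum_(t in T) (t - tau) ^+ k.+1 * \sum_(t' in T :\ t) (t - t')^-1
    = \sum_(t in T) \sum_(t' in T | t' != t) G t t'.
  apply: eq_bigr => t _; rewrite mulr_sumr; apply: eq_bigl => t'.
  by rewrite !inE andbC.
have swap : \sum_(t in T) \sum_(t' in T | t' != t) G t t'
    = \sum_(t in T) \sum_(t' in T | t' != t) G t' t.
  rewrite (exchange_big_dep (mem T)) /= => [|i j _ /andP[]//].
  by apply: eq_bigr => t tT; apply: eq_bigl => t'; rewrite tT eq_sym.
rewrite mulr_natl mulr2n {2}swap -big_split /=; apply: eq_bigr => t tT.
rewrite -big_split [in RHS](bigD1 t) //= complete_sym2_diag addrAC subrr add0r.
apply: eq_bigr => t' /andP[t'T t't].
rewrite complete_sym2_diff; last by rewrite (inj_eq (addIr _)) eq_sym.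
have tt' : t - t' != 0 by rewrite subr_eq0 eq_sym.
have t't0 : t' - t != 0 by rewrite subr_eq0.
have -> : t - tau - (t' - tau) = t - t' by ring.
by rewrite /G -[t' - t]opprB invrN mulrN mulrBl.
Qed.

(** When the power sums vanish up to degree n, the sum over S of a polynomial of
    degree at most n sees only its value at the center. *)
Lemma sum_poly_psum0 tau S (q : {poly F}) : (size q <= #|S|.+1)%N ->
  (forall k, (0 < k <= #|S|)%N -> psum tau S k = 0) ->
  \sum_(s in S) (q \Po ('X + (- tau)%:P)).[s] = #|S|%:R * q.[0].
Proof.
move=> szq p0.
rewrite (eq_bigr (fun s => \sum_(i < #|S|.+1) q`_i * (s - tau) ^+ i)) => [|s _]; last first.
  by rewrite horner_comp hornerD hornerX hornerC (horner_coef_wide _ szq).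
rewrite exchange_big big_ord_recl /= [X in _ + X]big1 => [|i _].
  rewrite addr0 -mulr_sumr -/(psum tau S 0) psum0 mulrC horner_coef0.
  by [].
by rewrite -mulr_sumr -/(psum tau S _) p0 ?mulr0 //= /bump /= ltnS ltn_ord.
Qed.

(** If all these power sums vanished, summing the root polynomial of S, which
    vanishes on S, would put tau in S; summing next that of S minus tau, which
    is nonzero only at tau, would give #|S| = 1 in F. *)
Lemma exists_psum_neq0 tau S : #|S|%:R != 0 :> F -> #|S|%:R != 1 :> F ->
  exists2 k, (0 < k <= #|S|)%N & psum tau S k != 0.
Proof.
move=> n0 n1; case: (boolP [exists k : 'I_#|S|, psum tau S k.+1 != 0]) => [/existsP[k pk]|].
  by exists k.+1; rewrite //= ltn_ord.
rewrite negb_exists => /forallP p0.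
have {}p0 k : (0 < k <= #|S|)%N -> psum tau S k = 0.
  by case: k => // k /= kS; apply/eqP; rewrite -[_ == _]negbK (p0 (Ordinal kS)).
have K (q : {poly F}) : (q \Po ('X + tau%:P)) \Po ('X + (- tau)%:P) = q.
  by rewrite polyCN comp_polyXaddC_K.
have sz (q : {poly F}) : size (q \Po ('X + tau%:P)) = size q.
  by rewrite size_comp_poly2 // size_XaddC.
have tS : tau \in S.
  have := @sum_poly_psum0 tau S (rootpoly S \Po ('X + tau%:P)).
  rewrite sz size_rootpoly leqnn K => /(_ isT p0).
  rewrite big1 => [|s sS]; last by apply/eqP; rewrite -[_ == _]/(root _ _) rootpoly_root.
  move/esym/eqP; rewrite mulf_eq0 (negPf n0) /= horner_comp hornerD hornerX hornerC add0r.
  by rewrite -[_ == _]/(root _ _) rootpoly_root.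
have szq : (size (rootpoly (S :\ tau) \Po ('X + tau%:P)) <= #|S|.+1)%N.
  by rewrite sz size_rootpoly [in leqRHS](cardsD1 tau) tS ltnW.
have := sum_poly_psum0 szq p0; rewrite K.
rewrite (bigD1 tau) //= big1 => [|s /andP[sS st]]; last first.
  by apply/eqP; rewrite -[_ == _]/(root _ _) rootpoly_root !inE st.
rewrite addr0 horner_comp hornerD hornerX hornerC add0r => E.
have nz : (rootpoly (S :\ tau)).[tau] != 0.
  by rewrite -[_ == _]/(root _ _) rootpoly_root !inE eqxx.
by move: n1; rewrite -(mulIf nz (etrans (mul1r _) E)) eqxx.
Qed.

End PowerSums.

Section LogRelation.
Variables (F : finFieldType) (S T : {set F}) (d : nat) (eps : F).
Hypothesis ext : extremal S T d eps.
Local Notation nF := (#|S|%:R : F).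

(** The first order local relation, with f''/f' and g'/g written as sums of
    reciprocals. *)
Lemma log_relation t : t \in T ->
  (nF + 1) * nF * \sum_(t' in T :\ t) (t - t')^-1
    = (d%:R - 1) * \sum_(s in S) (t - s)^-1.
Proof.
move=> tT; have [x1 [x2 [x3 [y1 [y2 [y3 [c2 [c3 [[X _ _] [Y _ _] L1 _ _]]]]]]]]] := local_expansion ext tT.
have h0 : (shift t (rootpoly S))`_0 != 0 := g0_neq0 (ext_eps ext) (ext_diff ext) (ext_d ext) tT.
have p0 : (shift t (rootpoly (T :\ t)))`_0 != 0 := phi0_neq0 T t.
have tS : t \notin S.
  by have := disjoint_ST ext; rewrite disjoint_sym => /disjointFr /(_ tT) ->.
have tT' : t \notin T :\ t by rewrite !inE eqxx.
have D (q : {poly F}) : (shift t q)`_1 = q^`().[t].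
  by rewrite -shift_coef0 shift_deriv coef_deriv_mulrl mul1r.
have <- : x1 = \sum_(t' in T :\ t) (t - t')^-1.
  by apply: (mulfI p0); rewrite -X D log_deriv_rootpoly // shift_coef0.
have <- : y1 = \sum_(s in S) (t - s)^-1.
  by apply: (mulfI h0); rewrite -Y D log_deriv_rootpoly // shift_coef0.
by rewrite -mulrA L1.
Qed.

End LogRelation.

Section Balanced.
Variables (F : finFieldType) (S T : {set F}) (d : nat) (eps : F).
Hypothesis ext : extremal S T d eps.
Hypothesis moments : forall k, (0 < k < d)%N ->
  \sum_(t in T) \sum_(s in S) (t - s) ^+ k = 0.
Local Notation n := #|S|.
Local Notation m := #|T|.
Local Notation nF := (#|S|%:R : F).
Local Notation mF := (#|T|%:R : F).

Lemma ord_inner k (i : 'I_k.+1) : i != ord0 -> i != ord_max -> (0 < i < k)%N.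
Proof. by move: (ltn_ord i); rewrite -!val_eqE /=; lia. Qed.

(** Binomial expansion of (t - s)^k around tau: the cross terms vanish by minimality
    of k. *)
Lemma moment_relation tau k : (0 < k < d)%N ->
    (forall i, (0 < i < k)%N -> psum tau S i = 0 /\ psum tau T i = 0) ->
  nF * psum tau T k + (-1) ^+ k * mF * psum tau S k = 0.
Proof.
move=> /[dup] kd /andP[k0 _] low; rewrite -(moments kd).
pose G (i : 'I_k.+1) := (-1) ^+ i * (psum tau T (k - i) * psum tau S i) *+ 'C(k, i).
transitivity (\sum_i G i).
  rewrite (bigD1 ord0) // (bigD1 ord_max) /=; last by rewrite -val_eqE /= -lt0n.
  rewrite big1 => [|i /andP[i0 ik]].
    rewrite /G /= subn0 subnn bin0 binn !psum0 expr0 !mulr1n mul1r addr0.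
    by ring.
  by have [pS0 _] := low i (ord_inner i0 ik); rewrite /G pS0 !mulr0 mul0rn.
transitivity (\sum_(t in T) \sum_(s in S) \sum_(i < k.+1)
    ((-1) ^+ i * ((t - tau) ^+ (k - i) * (s - tau) ^+ i) *+ 'C(k, i))).
  under [RHS]eq_bigr do rewrite exchange_big /=.
  rewrite [RHS]exchange_big; apply: eq_bigr => i _; rewrite /G /psum /=.
  rewrite mulr_suml mulr_sumr -sumrMnl; apply: eq_bigr => t _.
  by rewrite mulr_sumr mulr_sumr -sumrMnl.
apply: eq_bigr => t _; apply: eq_bigr => s _.
have -> : t - s = (t - tau) - (s - tau) by ring.
rewrite exprBn; apply: eq_bigr => i _.
by rewrite mulrA.
Qed.

(** Sum the logarithmic relation at t against (t - tau)^(k+1), and its analogue at s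
    against (s - tau)^(k+1).  All the sums become polynomial in power sums, and
    by minimality of k only their terms linear in the k-th ones remain. *)
Lemma interaction_relation tau k : (0 < k)%N ->
    (forall i, (0 < i < k)%N -> psum tau S i = 0 /\ psum tau T i = 0) ->
  (nF + 1) * nF * (2 * mF - k.+1%:R) * psum tau T k
    + (mF + 1) * mF * (2 * nF - k.+1%:R) * psum tau S k
  = 2 * (d%:R - 1) * (nF * psum tau T k + mF * psum tau S k).
Proof.
move=> k0 low.
have conv (A B : {set F}) : (forall i, (0 < i < k)%N -> psum tau A i = 0) ->
    \sum_(i < k.+1) psum tau B (k - i) * psum tau A i
      = psum tau B k * #|A|%:R + #|B|%:R * psum tau A k.
  move=> lowA; rewrite (bigD1 ord0) // (bigD1 ord_max) /=; last by rewrite -val_eqE /= -lt0n.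
  rewrite big1 => [|i /andP[i0 ik]]; first by rewrite addr0 subn0 subnn !psum0.
  by rewrite lowA ?mulr0 // ord_inner.
have lowS i : (0 < i < k)%N -> psum tau S i = 0 by move=> /low[].
have lowT i : (0 < i < k)%N -> psum tau T i = 0 by move=> /low[].
have IT := self_interaction tau T k; rewrite conv // in IT.
have IS := self_interaction tau S k; rewrite conv // in IS.
have mixed : \sum_(t in T) (t - tau) ^+ k.+1 * (\sum_(s in S) (t - s)^-1)
    + \sum_(s in S) (s - tau) ^+ k.+1 * (\sum_(t in T) (s - t)^-1)
    = psum tau T k * nF + mF * psum tau S k.
  rewrite -conv // -sum_complete_sym2.
  under [X in X + _]eq_bigr do rewrite mulr_sumr.
  under [X in _ + X]eq_bigr do rewrite mulr_sumr.
  rewrite [X in _ + X]exchange_big -big_split /=; apply: eq_bigr => t tT.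
  rewrite -big_split /=; apply: eq_bigr => s sS.
  have ts : t != s.
    by apply: contraTneq sS => <-; have := disjoint_ST ext; rewrite disjoint_sym => /disjointFr ->.
  rewrite complete_sym2_diff; last by rewrite (inj_eq (addIr _)).
  have -> : t - tau - (s - tau) = t - s by ring.
  by rewrite -[s - t]opprB invrN mulrN mulrBl.
have LT : (nF + 1) * nF * (\sum_(t in T) (t - tau) ^+ k.+1 * \sum_(t' in T :\ t) (t - t')^-1)
    = (d%:R - 1) * \sum_(t in T) (t - tau) ^+ k.+1 * (\sum_(s in S) (t - s)^-1).
  rewrite !mulr_sumr; apply: eq_bigr => t tT.
  by rewrite mulrCA (log_relation ext) // mulrCA.
have LS : (mF + 1) * mF * (\sum_(s in S) (s - tau) ^+ k.+1 * \sum_(s' in S :\ s) (s - s')^-1)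
    = (d%:R - 1) * \sum_(s in S) (s - tau) ^+ k.+1 * (\sum_(t in T) (s - t)^-1).
  rewrite !mulr_sumr; apply: eq_bigr => s sS.
  by rewrite mulrCA (log_relation (extremal_sym ext)) // mulrCA.
transitivity (2 * ((d%:R - 1) * (psum tau T k * nF + mF * psum tau S k))); last by ring.
rewrite -mixed [in RHS]mulrDr -LT -LS.
transitivity ((nF + 1) * nF * (psum tau T k * mF + mF * psum tau T k - k.+1%:R * psum tau T k)
  + (mF + 1) * mF * (psum tau S k * nF + nF * psum tau S k - k.+1%:R * psum tau S k)).
  by ring.
by rewrite -IT -IS; ring.
Qed.

Lemma natF_inj a b : (a < d + d)%N -> (b < d + d)%N -> a%:R = b%:R :> F -> a = b.
Proof.
wlog ab : a b / (a <= b)%N.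
  by move=> W; have [/W|/ltnW/W] := leqP a b => // H ad bd /esym /H ->.
move=> ad bd E; apply/eqP; rewrite eqn_leq ab leqNgt; apply/negP => lt_ab.
have /eqP[] : (b - a)%:R != 0 :> F by rewrite (ext_nat ext) // subn_gt0 lt_ab (leq_ltn_trans (leq_subr _ _)).
by rewrite natrB // E subrr.
Qed.

(** Let k be the first degree in which S or T has a nonzero power sum about the mean
    of T; then 1 < k <= n.  The two preceding relations are linear in the k-th power
    sums, and their determinant is, up to sign and a factor n m, (n + m + 2)(k - 1)
    for odd k and (n - m)(k + 3) for even k. *)
Theorem extremal_card_eq : n = m.
Proof.
have n1 := ext_S ext; have m1 := ext_T ext; have TS := ext_card ext; have d3 := ext_d ext.
have nm : (n + m <= d)%N by nia.
have nlt : (n + n <= d)%N by nia.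
have nd : (n < d + d)%N by nia.
have md : (m < d + d)%N by nia.
have natnz k : (0 < k < d + d)%N -> k%:R != 0 :> F := ext_nat ext (k := k).
have nz : nF != 0 by apply: natnz; lia.
have mz : mF != 0 by apply: natnz; lia.
pose tau := (\sum_(t in T) t) / mF.
have T1 : psum tau T 1 = 0.
  rewrite /psum; under eq_bigr do rewrite expr1.
  by rewrite sumrB sumr_const -mulr_natr mulfVK ?subrr.
have S1 : psum tau S 1 = 0.
  have := @moment_relation tau 1; rewrite T1 expr1 mulr0 add0r => H.
  have {H}/eqP : -1 * mF * psum tau S 1 = 0.
    by apply: H => [|i]; [lia | case: i].
  by rewrite !mulf_eq0 oppr_eq0 oner_eq0 (negPf mz) => /eqP.
pose P k := (0 < k)%N && ((psum tau S k != 0) || (psum tau T k != 0)).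
have [k0 /andP[k0pos k0n] pk0] : exists2 k, (0 < k <= n)%N & psum tau S k != 0.
  apply: exists_psum_neq0 => //; rewrite -subr_eq0 -(natrB _ (ltnW n1)) natnz //; lia.
have exP : exists k, P k by exists k0; rewrite /P pk0 k0pos.
have [k /andP[kpos pk] kmin] := ex_minnP exP.
have kn : (k <= n)%N.
  by apply: leq_trans k0n; apply: kmin; rewrite /P pk0 k0pos.
have low i : (0 < i < k)%N -> psum tau S i = 0 /\ psum tau T i = 0.
  move=> /andP[i0 ik]; have := contra (kmin i); rewrite -ltnNge ik => /(_ isT).
  by rewrite /P i0 negb_or !negbK => /andP[/eqP-> /eqP->].
have kd : (0 < k < d)%N by rewrite kpos; lia.
have k1 : (1 < k)%N.
  rewrite ltn_neqAle kpos andbT eq_sym; apply: contraTneq pk => ->.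
  by rewrite S1 T1 eqxx.
have M := moment_relation kd low.
have I := interaction_relation kpos low.
have dE : d%:R = mF * nF by rewrite -natrM TS.
have Sk : psum tau S k != 0.
  apply: contraTneq pk => Sk0; rewrite Sk0 eqxx /= negbK.
  by move/eqP: M; rewrite Sk0 mulr0 addr0 mulf_eq0 (negPf nz).
have kS : k.+1%:R = k%:R + 1 :> F by rewrite -natr1.
have {}I : (nF + 1) * (2 * mF - (k%:R + 1)) * (nF * psum tau T k)
    + (mF + 1) * (2 * nF - (k%:R + 1)) * (mF * psum tau S k)
    - 2 * (mF * nF - 1) * (nF * psum tau T k + mF * psum tau S k) = 0.
  by apply/eqP; rewrite subr_eq0; apply/eqP; rewrite -dE -I kS; ring.
have {}M : nF * psum tau T k = - ((-1) ^+ odd k * (mF * psum tau S k)).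
  by apply/eqP; rewrite -subr_eq0 opprK mulrA signr_odd M.
case: (boolP (odd k)) => ok; rewrite M ?ok ?(negPf ok) in I.
  have Z : (mF * psum tau S k) * ((mF + nF + 2) * (k%:R - 1)) = 0.
    by rewrite -[RHS]oppr0 -[in RHS]I expr1; ring.
  have /eqP[] : (mF * psum tau S k) * ((mF + nF + 2) * (k%:R - 1)) != 0.
    rewrite !mulf_neq0 // -?natrD ?natnz -?(natrB _ kpos) ?natnz //; lia.
  exact: Z.
have Z : (mF * psum tau S k) * ((nF - mF) * (k%:R + 3)) = 0.
  by rewrite -[RHS]I expr0; ring.
have k3 : k%:R + 3 != 0 :> F by rewrite -natrD natnz //; lia.
move/eqP: Z; rewrite !mulf_eq0 (negPf mz) (negPf Sk) (negPf k3) !orbF /= subr_eq0 => /eqP.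
exact: natF_inj nd md.
Qed.

End Balanced.

(** * The arithmetic of the obstruction *)

Section Arithmetic.
Local Open Scope nat_scope.

Lemma no_small_quartic_solution :
  all (fun n => all (fun q =>
    ~~ (q * n ^ 2 + 1 %| 3 * n ^ 2 + 5 * (q + 1) * n - 2 * (q + 1))) (iota 2 20)) (iota 3 22).
Proof. by vm_compute. Qed.

(** The left factor is p, and the right one is -q (3n^4+5n^3-2n^2-5n+2) reduced by
    q n^2 = -1.  A multiple of p of that size exists neither for n >= 25, by
    comparing leading terms, nor among the finitely many smaller candidates. *)
Lemma no_quartic_solution n q : 2 < n -> 1 < q ->
  ~~ (q * n ^ 2 + 1 %| 3 * n ^ 2 + 5 * (q + 1) * n - 2 * (q + 1)).
Proof.
move=> n3 q2; apply/negP => dvd; have [k kE] := dvdnP dvd.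
have nn : 3 * n <= n * n by rewrite leq_mul2r n3 orbT.
have qn : 3 * q <= q * n by rewrite mulnC leq_mul2l n3 orbT.
have {}kE : 3 * (n * n) + 5 * (q * n) + 5 * n = k * (q * (n * n) + 1) + 2 * q + 2.
  by move: kE; rewrite expnS expn1; lia.
have k0 : 0 < k by case: k kE => // kE; lia.
have lower k' : k' <= k -> k' * (q * (n * n) + 1) <= k * (q * (n * n) + 1).
  by move=> kk; rewrite leq_mul2r kk orbT.
have [n25|n25] := leqP 25 n.
  have nn25 : 25 * n <= n * n by rewrite leq_mul2r n25 orbT.
  have q4 : q < 4.
    rewrite ltnNge; apply/negP => q4; have := lower 1 k0.
    have : 4 * (n * n) <= q * (n * n) by rewrite leq_mul2r q4 orbT.
    have : 25 * (q * n) <= q * (n * n) by rewrite mulnCA leq_mul2l nn25 orbT.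
    by lia.
  have [q2'|q3'] : q = 2 \/ q = 3 by lia.
    subst q; have [k2|k2] := leqP 2 k; first by have := lower 2 k2; lia.
    have k1 : k = 1 by lia.
    by subst k; lia.
  subst q; have [k2|k2] := leqP 2 k; first by have := lower 2 k2; lia.
  have k1 : k = 1 by lia.
    by subst k; lia.
have q22 : q < 22.
  move: n3 n25 kE; have [k2|k2] := leqP 2 k.
    move: (lower 2 k2); clear -q2.
    by do 25! (case: n => [|n]; first by lia); lia.
  have -> : k = 1 by lia.
  clear -q2; by do 25! (case: n => [|n]; first by lia); lia.
have /allP/(_ n) := no_small_quartic_solution.
rewrite mem_iota n3 n25 => /(_ isT)/allP/(_ q).
by rewrite mem_iota q2 q22 dvd => /(_ isT).
Qed.

(** For a cofactor k, comparing terms in n^2 gives n < 4 if k q >= 4, and k = 1 with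
    q = 2 or 3 otherwise.  The solution corresponds to p = 19. *)
Lemma quadratic_solution n q : 2 < n -> 1 < q ->
  q * n ^ 2 + 1 %| 3 * n ^ 2 + 4 * n - 1 -> n = 3 /\ q = 2.
Proof.
move=> n3 q2 /dvdnP[k kE].
have nn : 3 * n <= n * n by rewrite leq_mul2r n3 orbT.
have {}kE : 3 * (n * n) + 4 * n = k * q * (n * n) + k + 1.
  by move: kE; rewrite expnS expn1; lia.
have rE : k * q * (n * n) = k * (q * (n * n)) by rewrite -mulnA.
have [r4|r4] := leqP 4 (k * q).
  have n4 : n < 4.
    rewrite ltnNge; apply/negP => n4.
    have : 4 * n <= n * n by rewrite leq_mul2r n4 orbT.
    have : 4 * (n * n) <= k * q * (n * n) by rewrite leq_mul2r r4 orbT.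
    by lia.
  have n3' : n = 3 by lia.
  subst n; have kq : k * q = 4 by lia.
  have k2 : k = 2 by lia.
  by subst k; split; lia.
have k2 : k < 2.
  rewrite ltnNge; apply/negP => k2.
  have : 2 * q <= k * q by rewrite leq_mul2r k2 orbT.
  by lia.
have [k0|k1] : k = 0 \/ k = 1 by lia.
  by subst k; lia.
subst k; have [q2'|q3'] : q = 2 \/ q = 3 by lia.
  by subst q; lia.
by subst q; lia.
Qed.
End Arithmetic.

(** * The exceptional prime 19 *)

Definition squares19 := [:: 1; 4; 5; 6; 7; 9; 11; 16; 17]%N.

Lemma squares19P (x : 'F_19) : x ^+ 9 = 1 -> (x : nat) \in squares19.
Proof.
have /allP H : all (fun k => (k%:R ^+ 9 == 1 :> 'F_19) ==> (k \in squares19)) (iota 0 19).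
  by vm_compute.
move=> x9; have := H (x : nat); rewrite mem_iota ltn_ord => /(_ isT).
by rewrite natr_Zp x9 eqxx.
Qed.

(** The sums of {a0, a1, a2} and {b0, b1, b2} in terms of u = a1 - a0, v = a2 - a0
    and h_i = a0 + b_i, reduced modulo 19. *)
Definition sums19 (u v h0 h1 h2 : nat) :=
  [:: h0; h1; h2; (h0 + u) %% 19; (h1 + u) %% 19; (h2 + u) %% 19;
      (h0 + v) %% 19; (h1 + v) %% 19; (h2 + v) %% 19]%N.

(** Restricting the h_i to the list K keeps the enumeration small: |K| <= 4 unless
    u = v = 0. *)
Lemma sums19_check :
  all (fun u => all (fun v =>
    let K := [seq h <- squares19 |
               ((h + u) %% 19 \in squares19)%N && ((h + v) %% 19 \in squares19)%N] in
    all (fun h0 => all (fun h1 => all (fun h2 => ~~ uniq (sums19 u v h0 h1 h2)) K) K) K)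
    (iota 0 19)) (iota 0 19).
Proof. by vm_compute. Qed.

(** Equivalent to a search over all pairs of triples, reduced to [sums19_check] by
    translating by a0. *)
Lemma no_decomposition19 (p : nat) (A B : {set 'F_p}) : p = 19%N -> #|A| = 3%N -> #|B| = 3%N ->
  {in A & B, forall a b, (a + b) ^+ 9 = 1} -> (#|sumset A B| < 9)%N.
Proof.
move=> p19; move: A B; rewrite p19 => A B; rewrite [#|A|]cardE [#|B|]cardE ltnNge => cA cB sq; apply/negP => card9.
have := enum_uniq A; have := mem_enum A.
case: (enum A) cA => [|a0 [|a1 [|a2 []]]] //= _ memA uA.
have := enum_uniq B; have := mem_enum B.
case: (enum B) cB => [|b0 [|b1 [|b2 []]]] //= _ memB uB.
have /and3P[A0 A1 A2] : [&& a0 \in A, a1 \in A & a2 \in A] by rewrite -!memA !inE !eqxx !orbT.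
have /and3P[B0 B1 B2] : [&& b0 \in B, b1 \in B & b2 \in B] by rewrite -!memB !inE !eqxx !orbT.
pose s := [seq a + b | a <- [:: a0; a1; a2], b <- [:: b0; b1; b2]].
have us : uniq s.
  apply/card_uniqP/eqP; rewrite eqn_leq card_size; apply: leq_trans card9 _.
  apply/subset_leq_card/subsetP => _ /imset2P[a b aA bB ->].
  by apply: allpairs_f; rewrite ?memA ?memB.
have translate (a b : 'F_19) :
    (((a0 + b)%R + (a - a0)%R) %% 19)%N = nat_of_ord (a + b).
  by rewrite -[LHS]/(nat_of_ord (a0 + b + (a - a0))) addrAC [a0 + _]addrC subrK.
have vs : map (@nat_of_ord _) s
    = sums19 (a1 - a0)%R (a2 - a0)%R (a0 + b0)%R (a0 + b1)%R (a0 + b2)%R.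
  by rewrite /sums19 !translate.
have in19 a b : a \in A -> b \in B -> nat_of_ord (a + b) \in squares19.
  by move=> aA bB; apply: squares19P; apply: sq.
have common b : b \in B -> nat_of_ord (a0 + b) \in
    [seq h <- squares19 | ((h + (a1 - a0)%R) %% 19 \in squares19)%N
                          && ((h + (a2 - a0)%R) %% 19 \in squares19)%N].
  by move=> bB; rewrite mem_filter !translate !in19.
have /allP/(_ (a1 - a0)%R) := sums19_check.
rewrite mem_iota ltn_ord => /(_ isT)/allP/(_ (a2 - a0)%R).
rewrite mem_iota ltn_ord => /(_ isT)/allP/(_ _ (common _ B0)).
move=> /allP/(_ _ (common _ B1))/allP/(_ _ (common _ B2)).
by rewrite -vs map_inj_uniq ?us //; apply: ord_inj.
Qed.

Local Close Scope ring_scope.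

(** * Subgroups of the multiplicative group *)

Section Subgroup.
Local Open Scope ring_scope.
Variables (F : finFieldType) (H : {group {unit F}}).
Local Notation d := #|H|.

Lemma card_units_in : #|units_in H| = d.
Proof. by rewrite card_imset //; apply: val_inj. Qed.

Lemma units_in_exp x : x \in units_in H -> x ^+ d = 1.
Proof.
case/imsetP => u uH ->.
by rewrite -[FinRing.uval u]/(val u) -FinRing.val_unitX expg_cardG.
Qed.

Lemma units_in1 : 1 \in units_in H.
Proof. by apply/imsetP; exists 1%g; rewrite ?group1. Qed.

Lemma units_inM_perm g : g \in units_in H ->
  {in units_in H, forall x, g * x \in units_in H}.
Proof.
case/imsetP => u uH -> _ /imsetP[v vH ->].
by apply/imsetP; exists (u * v)%g; rewrite ?groupM.
Qed.

(** Multiplication by g permutes H, so the sum is fixed by multiplication by g^k, and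
    some g in H has g^k <> 1 because X^k - 1 has fewer than #|H| roots. *)
Lemma power_sum_units_in k : (0 < k < d)%N -> \sum_(x in units_in H) x ^+ k = 0.
Proof.
move=> /andP[k0 kd].
have [g gH gk] : exists2 g, g \in units_in H & g ^+ k != 1.
  apply/exists_inP; apply: contraT; rewrite negb_exists_in => /forall_inP all1.
  have : 'X^k - 1%:P = 0 :> {poly F}.
    apply: (@poly_eq0_on _ (units_in H)) => [|x /all1/negPn/eqP xk].
      by rewrite card_units_in size_XnsubC.
    by rewrite hornerD hornerN hornerXn hornerC xk subrr.
  by move/eqP; rewrite -size_poly_eq0 size_XnsubC.
have g0 : g != 0.
  by apply: contraNneq (oner_neq0 F) => g0; rewrite -(units_in_exp gH) g0 expr0n gtn_eqF // (leq_trans _ kd).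
have : (g ^+ k - 1) * \sum_(x in units_in H) x ^+ k = 0.
  rewrite mulrBl mul1r; apply/eqP; rewrite subr_eq0; apply/eqP.
  have permH : [set g * x | x in units_in H] = units_in H.
    apply/eqP; rewrite eqEcard (card_imset _ (mulfI g0)) leqnn andbT.
    by apply/subsetP => _ /imsetP[x xH ->]; apply: units_inM_perm.
  rewrite -{2}permH (big_imset _ (in2W (mulfI g0))) /=.
  by rewrite mulr_sumr; apply: eq_bigr => x _; rewrite exprMn.
by move/eqP; rewrite mulf_eq0 subr_eq0 (negPf gk) => /eqP.
Qed.

End Subgroup.

Lemma sum_over_sumset (F : finFieldType) (A B : {set F}) (h : F -> F) :
    #|sumset A B| = (#|A| * #|B|)%N ->
  (\sum_(t in B) \sum_(s in [set - a | a in A]) h (t - s) = \sum_(x in sumset A B) h x)%R.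
Proof.
rewrite /sumset curry_imset2X -cardsX => /eqP/imset_injP inj.
rewrite big_imset //= exchange_big big_imset /=; last exact: in2W oppr_inj.
rewrite pair_big /=; apply: eq_big => [[a b]|[a b] _] /=; first by rewrite inE.
by rewrite opprK addrC.
Qed.

Section PrimeField.
Local Open Scope ring_scope.
Variables (p : nat) (p_prime : prime p).

Lemma natFp_eq0 k : (k%:R == 0 :> 'F_p) = (p %| k)%N.
Proof. by rewrite (dvdn_pcharf (pchar_Fp p_prime)). Qed.

Lemma quad_factor_dvd n : (0 < n)%N -> quad_factor (n%:R : 'F_p) = 0 -> (p %| 3 * n ^ 2 + 4 * n - 1)%N.
Proof.
move=> n0 E; rewrite -natFp_eq0 natrB; last by lia.
by apply/eqP; rewrite -[RHS]E /quad_factor !(natrD, natrM); ring.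
Qed.

Lemma quart_factor_dvd n q : (0 < n)%N -> p = (q * n ^ 2 + 1)%N -> quart_factor (n%:R : 'F_p) = 0 ->
  (p %| 3 * n ^ 2 + 5 * (q + 1) * n - 2 * (q + 1))%N.
Proof.
move=> n0 pE G0; rewrite -natFp_eq0 natrB; last by nia.
have p0 : q%:R * n%:R ^+ 2 + 1 = 0 :> 'F_p.
  have : (q * n ^ 2 + 1)%:R == 0 :> 'F_p by rewrite natFp_eq0 -pE dvdnn.
  by rewrite natrD natrM natrX => /eqP.
rewrite !(natrD, natrM).
have -> : 3 * (n%:R * n%:R) + 5 * (q%:R + 1) * n%:R - 2 * (q%:R + 1)
   = (3 * n%:R ^+ 2 + 5 * n%:R - 2) * (q%:R * n%:R ^+ 2 + 1) - q%:R * quart_factor (n%:R : 'F_p).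
  by rewrite /quart_factor; ring.
by rewrite p0 G0 !mulr0 subrr.
Qed.

Variables (H : {group {unit 'F_p}}) (H_proper : H \proper [set: {unit 'F_p}]).
Variables (A B : {set 'F_p}) (HE : units_in H = sumset A B).
Local Notation d := #|H|.

Lemma card_subgroup : exists2 q, (1 < q)%N & p = (q * d + 1)%N.
Proof.
have cardU : #|[set: {unit 'F_p}]| = p.-1 by rewrite card_finField_unit card_Fp.
have := proper_card H_proper; have := cardSg (subsetT H); rewrite cardU.
case/dvdnP=> q qE lt; have p1 := prime_gt1 p_prime; exists q; last by lia.
by rewrite qE in lt; move: lt; rewrite -[X in (X < _)%N]mul1n ltn_mul2r => /andP[].
Qed.

Lemma sumset_exp : {in A & B, forall a b, (a + b) ^+ d = 1}.
Proof.
by move=> a b aA bB; apply: units_in_exp; rewrite HE; apply/imset2P; exists a b.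
Qed.

Let S := [set - a | a in A].

Lemma card_S : #|S| = #|A|.
Proof. by rewrite card_imset //; apply: oppr_inj. Qed.

Lemma diff_exp : {in B & S, forall t s, (t - s) ^+ d = 1}.
Proof. by move=> b _ bB /imsetP[a aA ->]; rewrite opprK addrC sumset_exp. Qed.

Lemma sumset_card_le : (d <= #|A| * #|B|)%N.
Proof.
by rewrite -card_units_in HE /sumset curry_imset2X -cardsX leq_imset_card.
Qed.

Hypotheses (A1 : (1 < #|A|)%N) (B1 : (1 < #|B|)%N).

Lemma natFp_neq0 k : (0 < k < d + d)%N -> k%:R != 0 :> 'F_p.
Proof.
have [q q1 pE] := card_subgroup; move=> /andP[k0 kd]; rewrite natFp_eq0 gtnNdvd //.
rewrite pE; have : (2 * d <= q * d)%N by rewrite leq_mul2r q1 orbT.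
lia.
Qed.

Lemma card_A_le : (#|A| <= d)%N.
Proof.
have [b bB] : exists b, b \in B by apply/card_gt0P; apply: ltnW.
rewrite -card_units_in -(card_imset A (addIr b)).
by apply/subset_leq_card/subsetP => _ /imsetP[a aA ->]; rewrite HE; apply/imset2P; exists a b.
Qed.

(** Stepanov's bound and #|A + B| <= #|A| #|B| squeeze #|H|.  The bound needs
    d + n <= p, which holds since n <= d and 2d < p. *)
Lemma sumset_extremal : extremal S B d 1.
Proof.
have S0 : (0 < #|S|)%N by rewrite card_S ltnW.
have nzS k : (0 < k < d + #|S|)%N -> k%:R != 0 :> 'F_p.
  move=> /andP[k0 kd]; apply: natFp_neq0; rewrite k0 (leq_trans kd) //.
  by rewrite leq_add2l card_S card_A_le.
have d0 : (0 < d)%N := cardG_gt0 H.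
have TS : (#|B| * #|S|)%N = d.
  apply/eqP; rewrite eqn_leq; apply/andP; split; last first.
    by rewrite card_S mulnC sumset_card_le.
  apply: (stepanov_bound S0 diff_exp d0).
  by apply: bin_natf_neq0 => //; rewrite leq_addr.
split=> //; rewrite ?card_S ?oner_neq0 //.
- by rewrite -TS card_S; nia.
- exact: diff_exp.
exact: natFp_neq0.
Qed.

Lemma sumset_moments k : (0 < k < d)%N ->
  \sum_(t in B) \sum_(s in S) (t - s) ^+ k = 0.
Proof.
move=> kd; rewrite (sum_over_sumset (fun x => x ^+ k)) -HE ?power_sum_units_in //.
by rewrite card_units_in -(ext_card sumset_extremal) card_S mulnC.
Qed.

Lemma subgroup_sumset_cards : [/\ #|A| = 2, #|B| = 2, d = 4 & p = 1 %[mod 4]]%N.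
Proof.
have ext := sumset_extremal.
have BS : #|B| = #|S| := esym (extremal_card_eq ext sumset_moments).
have dE : d = (#|A| ^ 2)%N by rewrite -(ext_card ext) BS card_S -mulnn.
have [q q1 pE] := card_subgroup.
have [n2|n2] := eqVneq #|A| 2.
  have d4 : d = 4 by rewrite dE n2.
  by split=> //; [rewrite BS card_S | rewrite pE d4 modnMDl].
have n3 : (2 < #|A|)%N by rewrite ltn_neqAle eq_sym n2.
have n0 : (0 < #|A|)%N := ltnW A1.
have pE' : p = (q * #|A| ^ 2 + 1)%N by rewrite -dE.
have := square_obstruction ext BS; rewrite card_S => /eqP.
have nm2 : #|A|%:R - 2 != 0 :> 'F_p.
  rewrite -natrB ?(ltnW n3) // natFp_neq0 // subn_gt0 n3 /=.
  by rewrite (leq_ltn_trans (leq_subr _ _)) // (leq_ltn_trans card_A_le) // -[X in (X < _)%N]addn0 ltn_add2l cardG_gt0.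
rewrite !mulf_eq0 (negPf nm2) /= => /orP[/eqP E0|/eqP G0]; last first.
  by have := no_quartic_solution n3 q1; rewrite -pE' (quart_factor_dvd n0 pE' G0).
have := @quadratic_solution #|A| q n3 q1.
rewrite -pE' (quad_factor_dvd n0 E0) => /(_ isT)[A3 q2].
have p19 : p = 19 by rewrite pE' A3 q2.
exfalso; have B3 : #|B| = 3 by rewrite BS card_S A3.
have d9 : d = 9 by rewrite dE A3.
have AB9 : #|sumset A B| = 9 by rewrite -HE card_units_in.
have exp9 := sumset_exp; rewrite d9 in exp9.
by have := no_decomposition19 p19 A3 B3 exp9; rewrite AB9.
Qed.

End PrimeField.

Theorem theorem1p1 (p : nat) (p_prime : prime p) (H : {group {unit 'F_p}})
    (H_proper : H \proper [set: {unit 'F_p}]) :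
  (forall A B : {set 'F_p}, units_in H = sumset A B ->
     (#|A| = 1 \/ #|B| = 1) \/
     [/\ #|A| = 2, #|B| = 2, #|H| = 4 & p = 1 %[mod 4]]) /\
  ~ (exists A B : {set 'F_p},
       [/\ units_in H = sumset A B, 2 < #|A| & 2 < #|B|]).
Proof.
have main (A B : {set 'F_p}) : units_in H = sumset A B ->
     (#|A| = 1 \/ #|B| = 1) \/
     [/\ #|A| = 2, #|B| = 2, #|H| = 4 & p = 1 %[mod 4]].
  move=> HE; have := units_in1 H; rewrite HE => /imset2P[a b aA bB _].
  have A0 : 0 < #|A| by apply/card_gt0P; exists a.
  have B0 : 0 < #|B| by apply/card_gt0P; exists b.
  have [A1|A1] := eqVneq #|A| 1; first by left; left.
  have [B1|B1] := eqVneq #|B| 1; first by left; right.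
  by right; apply: (subgroup_sumset_cards p_prime H_proper HE); rewrite ltn_neqAle eq_sym ?A1 ?B1.
split=> // -[A [B [/main[[]|[]] -> //]]].
Qed.
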